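(* Let $\beta>0$ and let $g=\phi^2 g_{flat}$ be a Riemannian metric on the flat Möbius strip $M_\beta$ ($\phi$ smooth and positive), i.e. $g\in C_\beta$. Then $$\alpha_{sys}(M,C_\beta)=\alpha_{sys}(M_\beta,g_\beta)=\begin{cases}\frac{2}{\pi}\tanh\beta, & \beta\le\beta_1,\\[2pt] \frac{\sqrt3}{\pi}+\frac{\beta-\beta_1}{2\pi}, & \beta>\beta_1,\end{cases}$$ and $$\frac{\|\phi-P_{\phi_\beta}(\phi)\|_{L^2}^2}{\mathrm{sys}^2(M_\beta,g)}\le \alpha_{sys}(M_\beta,g)-\alpha_{sys}(M,C_\beta).$$ In particular, $\alpha_{sys}(M_\beta,g)=\alpha_{sys}(M,C_\beta)$ holds if and only if $\phi$ is a positive multiple of $\phi_\beta$.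
   Context: Let $S_\beta=\mathbb{R}\times[-\beta,\beta]$ with the Euclidean metric, $A(x,y)=(x+\pi,-y)$, and $M_\beta=S_\beta/\{A^k:k\in\mathbb{Z}\}$ with the induced flat metric $g_{flat}$ (quotient map $p$ a local isometry); functions on $M_\beta$ are identified with $A$-invariant functions on $S_\beta$. $C_\beta$ denotes the conformal class of $g_{flat}$ on $M_\beta$, i.e. Riemannian metrics $\phi^2 g_{flat}$ with $\phi$ smooth positive. For a (possibly only continuous) conformal metric $\psi^2 g_{flat}$, lengths are $\int\psi(\gamma)|\gamma'|_{g_{flat}}dt$, area is $\int\psi^2 d\mathrm{vol}_{g_{flat}}$, $\mathrm{sys}$ is the infimum of lengths of noncontractible closed curves, and $\alpha_{sys}=\mathrm{area}/\mathrm{sys}^2$; $\alpha_{sys}(M,C_\beta)=\inf_{g\in C_\beta}\alpha_{sys}(M_\beta,g)$. Let $\phi_0(y)=\frac{2e^y}{1+e^{2y}}$, $\beta_1=\log(2+\sqrt3)$, $\phi_\beta(p(x,y))=\max\{\phi_0(y),\frac12\}$, $g_\beta=\phi_\beta^2 g_{flat}$ (a continuous metric), and $P_{\phi_\beta}(\phi)=\frac{(\phi,\phi_\beta)_{L^2}}{(\phi_\beta,\phi_\beta)_{L^2}}\phi_\beta$ the $L^2(M_\beta,g_{flat})$-orthogonal projection onto $\mathbb{R}\phi_\beta$. *)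

(* Defs.v *)
From Stdlib Require Import Reals.
From Coquelicot Require Import Coquelicot.
Open Scope R_scope.

Definition in_strip (beta x y : R) : Prop := -beta <= y <= beta.

Definition Ak_x (k : Z) (x : R) : R := x + IZR k * PI.
Definition Ak_y (k : Z) (y : R) : R := (-1) ^ (Z.abs_nat k) * y.

(* Functions on M_beta = A-invariant functions on S_beta. *)
Definition A_invariant (beta : R) (f : R -> R -> R) : Prop :=
  forall x y, in_strip beta x y -> f (x + PI) (- y) = f x y.

Fixpoint Cn (n : nat) (U : R -> R -> Prop) (f : R -> R -> R) : Prop :=
  match n with
  | O => forall x y, U x y ->
           continuous (fun p : R * R => f (fst p) (snd p)) (x, y)
  | S m =>
      (forall x y, U x y ->
         continuous (fun p : R * R => f (fst p) (snd p)) (x, y)) /\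
      (forall x y, U x y ->
         ex_derive (fun t => f t y) x /\ ex_derive (fun t => f x t) y) /\
      Cn m U (fun x y => Derive (fun t => f t y) x) /\
      Cn m U (fun x y => Derive (fun t => f x t) y)
  end.

Definition smooth_on (U : R -> R -> Prop) (f : R -> R -> R) : Prop :=
  forall n, Cn n U f.

(* phi is a smooth positive function on M_beta (smooth up to the boundary,
   i.e. smooth on an open neighbourhood of the closed strip), so that
   phi^2 g_flat is an element of the conformal class C_beta. *)
Definition conformal_factor (beta : R) (phi : R -> R -> R) : Prop :=
  (forall x y, in_strip beta x y -> 0 < phi x y) /\
  A_invariant beta phi /\
  (exists eps, 0 < eps /\
     smooth_on (fun x y => - beta - eps < y < beta + eps) phi).

(* Non-contractible closed curves in M_beta, described by their lifts:
   a C^1 path gamma : [0,1] -> S_beta with gamma(1) = A^k gamma(0), k <> 0. *)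
Definition nc_closed_curve (beta : R) (gx gy : R -> R) (k : Z) : Prop :=
  k <> 0%Z /\
  (forall t, ex_derive gx t /\ ex_derive gy t) /\
  (forall t, 0 <= t <= 1 ->
     continuous (Derive gx) t /\ continuous (Derive gy) t /\
     in_strip beta (gx t) (gy t)) /\
  gx 1 = Ak_x k (gx 0) /\ gy 1 = Ak_y k (gy 0).

Definition curve_length (psi : R -> R -> R) (gx gy : R -> R) : R :=
  RInt (fun t => psi (gx t) (gy t) *
                 sqrt (Derive gx t ^ 2 + Derive gy t ^ 2)) 0 1.

(* L^2(M_beta, g_flat) inner product: integral over the fundamental domain
   [0,pi] x [-beta,beta]. *)
Definition L2_inner (beta : R) (f g : R -> R -> R) : R :=
  RInt (fun x => RInt (fun y => f x y * g x y) (- beta) beta) 0 PI.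

Definition area (beta : R) (psi : R -> R -> R) : R := L2_inner beta psi psi.

Definition sys (beta : R) (psi : R -> R -> R) : R :=
  real (Glb_Rbar (fun L => exists gx gy k,
          nc_closed_curve beta gx gy k /\ L = curve_length psi gx gy)).

Definition alpha_sys (beta : R) (psi : R -> R -> R) : R :=
  area beta psi / (sys beta psi) ^ 2.

Definition alpha_sys_conf (beta : R) : R :=
  real (Glb_Rbar (fun a => exists phi,
          conformal_factor beta phi /\ a = alpha_sys beta phi)).

Definition phi0 (y : R) : R := 2 * exp y / (1 + exp (2 * y)).
Definition beta1 : R := ln (2 + sqrt 3).
Definition phi_beta (x y : R) : R := Rmax (phi0 y) (1 / 2).

Definition tanh_ (b : R) : R := (exp b - exp (- b)) / (exp b + exp (- b)).

Definition proj_phi_beta (beta : R) (phi : R -> R -> R) : R -> R -> R :=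
  fun x y => (L2_inner beta phi phi_beta / L2_inner beta phi_beta phi_beta)
             * phi_beta x y.

(* Main.v *)
(* The extremal metric [phi_beta ^ 2 g_flat] is covered by a family of closed
   curves of length [PI], its systole: [phi0 = 1 / cosh] is the conformal factor
   of the round sphere in Mercator coordinates, [A] is the antipodal map, and the
   curves are the great semicircles [sinh y = c sin (x - x0)] staying in
   [|y| <= min beta beta1], together with the parallels at height [y >= beta1],
   where the metric is a flat cylinder of circumference [PI].  Inverting an Abel
   transform gives a measure on these curves for which the average of the length
   of the curves for [phi ^ 2 g_flat] is the L2 product [(phi, phi_beta)], up to a
   constant.  Since every length is at least [sys phi], this yields
   [sys phi * (phi_beta, phi_beta) <= PI * (phi, phi_beta)], and Pythagoras'
   theorem in L2 turns it into the stability inequality.  For [beta > beta1] the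
   factor [phi_beta] is only continuous, and the infimum is reached along smooth
   majorants converging uniformly to it. *)

Require Import Defs.
From Stdlib Require Import Reals Lra Lia ZArith FunctionalExtensionality.
From Coquelicot Require Import Coquelicot.
Open Scope R_scope.

(** * Continuity and integrals of functions of two variables *)

(** The constant 1/2 in [phi_beta] comes from curves winding at least twice: where the factor is
    1/2, a parallel, of flat length 2 PI, has length exactly PI. Curves winding once join antipodal
    points of the round sphere. Both families therefore have the same minimal length PI, and [beta1]
    is the height where 1 / cosh y = 1/2.

    Inverting the Abel transform directly would mean changing variables in a double integral with a
    singular weight. It is replaced by an identity, linear in a continuous test function h, between
    two integrals with continuous weights. For monomials both sides obey the same first-order
    recursion; Bernstein polynomials and sup-norm bounds extend the identity to all continuous h.

    A conformal factor is constrained only near the strip, while the integral lemmas are stated for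
    functions continuous everywhere. The argument is therefore run on a continuous, positive,
    invariant extension to the whole plane, which has the same systole and the same L2 products. *)

Definition continuous2 (f : R -> R -> R) : Prop :=
  forall x y, continuous (fun p : R * R => f (fst p) (snd p)) (x, y).

(* Coquelicot often types an equation in a structure whose carrier is only
   convertible to [R], which [ring] and [field] reject. *)
Ltac as_R := match goal with |- ?a = ?b => change (@eq R a b) end.

Lemma cont_plus {U : UniformSpace} (f g : U -> R) (x : U) :
  continuous f x -> continuous g x -> continuous (fun t => f t + g t) x.
Proof. intros Hf Hg. exact (continuous_plus f g x Hf Hg). Qed.

Lemma cont_opp {U : UniformSpace} (f : U -> R) (x : U) :
  continuous f x -> continuous (fun t => - f t) x.
Proof. intros Hf. exact (continuous_opp f x Hf). Qed.

Lemma cont_minus {U : UniformSpace} (f g : U -> R) (x : U) :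
  continuous f x -> continuous g x -> continuous (fun t => f t - g t) x.
Proof. intros Hf Hg. exact (continuous_minus f g x Hf Hg). Qed.

Lemma cont_mult {U : UniformSpace} (f g : U -> R) (x : U) :
  continuous f x -> continuous g x -> continuous (fun t => f t * g t) x.
Proof. intros Hf Hg. exact (continuous_mult f g x Hf Hg). Qed.

Lemma cont_pow {U : UniformSpace} (f : U -> R) (n : nat) (x : U) :
  continuous f x -> continuous (fun t => f t ^ n) x.
Proof.
  intros Hf; induction n as [|n IH]; simpl.
  - apply continuous_const.
  - now apply cont_mult.
Qed.

Lemma cont_inv {U : UniformSpace} (f : U -> R) (x : U) :
  continuous f x -> f x <> 0 -> continuous (fun t => / f t) x.
Proof.
  intros Hf H0. apply (continuous_comp f Rinv); auto.
  now apply continuous_Rinv.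
Qed.

Lemma cont_div {U : UniformSpace} (f g : U -> R) (x : U) :
  continuous f x -> continuous g x -> g x <> 0 ->
  continuous (fun t => f t / g t) x.
Proof. intros; apply cont_mult; auto; now apply cont_inv. Qed.

Lemma cont_comp {U : UniformSpace} (h : R -> R) (f : U -> R) (x : U) :
  (forall y, continuous h y) -> continuous f x ->
  continuous (fun t => h (f t)) x.
Proof. intros Hh Hf. apply (continuous_comp f h); auto. Qed.

Lemma cont_comp2 {U : UniformSpace} (h : R -> R -> R) (f g : U -> R) (x : U) :
  continuous2 h -> continuous f x -> continuous g x ->
  continuous (fun t => h (f t) (g t)) x.
Proof. intros Hh Hf Hg. apply (continuous_comp_2 f g h x Hf Hg); apply Hh. Qed.

Lemma cont_sin (x : R) : continuous sin x.
Proof. apply continuity_pt_filterlim, continuity_sin. Qed.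

Lemma cont_cos (x : R) : continuous cos x.
Proof. apply continuity_pt_filterlim, continuity_cos. Qed.

Lemma cont_exp (x : R) : continuous exp x.
Proof. apply continuity_pt_filterlim, derivable_continuous_pt, derivable_pt_exp. Qed.

Lemma cont_arcsinh (x : R) : continuous arcsinh x.
Proof.
  apply (ex_derive_continuous (K := R_AbsRing) (V := R_NormedModule)).
  eexists. apply is_derive_Reals, derivable_pt_lim_arcsinh.
Qed.

Lemma cont_max {U : UniformSpace} (f g : U -> R) (x : U) :
  continuous f x -> continuous g x -> continuous (fun t => Rmax (f t) (g t)) x.
Proof.
  intros Hf Hg.
  apply (continuous_ext (fun t => (f t + g t + Rabs (f t - g t)) * / 2)).
  - intros t. as_R.
    unfold Rmax; destruct Rle_dec.
    + rewrite Rabs_left1 by lra. field.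
    + rewrite Rabs_right by lra. field.
  - apply cont_mult; [|apply continuous_const].
    apply cont_plus; [now apply cont_plus|].
    apply (cont_comp Rabs); [apply continuous_Rabs | now apply cont_minus].
Qed.

Ltac cont :=
  repeat match goal with
  | |- continuous (fun _ => ?c) _ => apply continuous_const
  | |- continuous (fun x => x) _ => apply continuous_id
  | |- continuous fst _ => apply continuous_fst
  | |- continuous snd _ => apply continuous_snd
  | |- continuous (fun x => fst x) _ => apply continuous_fst
  | |- continuous (fun x => snd x) _ => apply continuous_snd
  | |- continuous (fun x => @?f x + @?g x) _ => apply (cont_plus f g)
  | |- continuous (fun x => @?f x - @?g x) _ => apply (cont_minus f g)
  | |- continuous (fun x => - @?f x) _ => apply (cont_opp f)
  | |- continuous (fun x => @?f x * @?g x) _ => apply (cont_mult f g)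
  | |- continuous (fun x => @?f x / @?g x) _ => apply (cont_div f g)
  | |- continuous (fun x => / @?f x) _ => apply (cont_inv f)
  | |- continuous (fun x => (@?f x) ^ ?n) _ => apply (cont_pow f n)
  | |- continuous (fun x => Rmax (@?f x) (@?g x)) _ => apply (cont_max f g)
  | |- continuous (fun x => sin (@?f x)) _ => apply (cont_comp sin f); [apply cont_sin|]
  | |- continuous (fun x => cos (@?f x)) _ => apply (cont_comp cos f); [apply cont_cos|]
  | |- continuous (fun x => exp (@?f x)) _ => apply (cont_comp exp f); [apply cont_exp|]
  | |- continuous (fun x => sqrt (@?f x)) _ => apply (cont_comp sqrt f); [apply continuous_sqrt|]
  | |- continuous (fun x => arcsinh (@?f x)) _ => apply (cont_comp arcsinh f); [apply cont_arcsinh|]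
  | H : forall y, continuous ?h y |- continuous ?h _ => apply H
  | H : forall y, continuous ?h y |- continuous (fun x => ?h (@?f x)) _ =>
      apply (cont_comp h f); [exact H|]
  | H : continuous2 ?h |- continuous (fun x => ?h (@?f x) (@?g x)) _ =>
      apply (cont_comp2 h f g); [exact H| |]
  end.

Lemma continuous2_pt (f : R -> R -> R) :
  continuous2 f -> forall x y, continuity_2d_pt f x y.
Proof. intros H x y. apply continuity_2d_pt_filterlim, H. Qed.

Lemma ex_RInt_cont (f : R -> R) (a b : R) :
  (forall x, continuous f x) -> ex_RInt f a b.
Proof. intros H; apply (ex_RInt_continuous (V := R_CompleteNormedModule)); auto. Qed.

Lemma RInt_add (f g : R -> R) (a b : R) :
  (forall x, continuous f x) -> (forall x, continuous g x) ->
  RInt (fun x => f x + g x) a b = RInt f a b + RInt g a b.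
Proof. intros. apply (RInt_plus f g); now apply ex_RInt_cont. Qed.

Lemma RInt_sub (f g : R -> R) (a b : R) :
  (forall x, continuous f x) -> (forall x, continuous g x) ->
  RInt (fun x => f x - g x) a b = RInt f a b - RInt g a b.
Proof. intros. apply (RInt_minus f g); now apply ex_RInt_cont. Qed.

Lemma RInt_mulc (f : R -> R) (c a b : R) :
  (forall x, continuous f x) ->
  RInt (fun x => c * f x) a b = c * RInt f a b.
Proof. intros. apply (RInt_scal f a b c); now apply ex_RInt_cont. Qed.

Lemma RInt_cst (c a b : R) : RInt (fun _ => c) a b = (b - a) * c.
Proof. exact (RInt_const a b c). Qed.

Lemma RInt_split (f : R -> R) (a b c : R) :
  (forall x, continuous f x) -> RInt f a c = RInt f a b + RInt f b c.
Proof. intros. symmetry. apply (RInt_Chasles f a b c); now apply ex_RInt_cont. Qed.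

Lemma RInt_mono (f g : R -> R) (a b : R) :
  (forall x, continuous f x) -> (forall x, continuous g x) ->
  a <= b -> (forall x, a <= x <= b -> f x <= g x) -> RInt f a b <= RInt g a b.
Proof.
  intros Hf Hg Hab H. apply RInt_le; auto; try (now apply ex_RInt_cont).
  intros; apply H; lra.
Qed.

Lemma RInt_antiderivative (F f : R -> R) (a b : R) :
  (forall x, is_derive F x (f x)) -> (forall x, continuous f x) ->
  RInt f a b = F b - F a.
Proof.
  intros HF Hf. apply is_RInt_unique.
  apply (is_RInt_derive (V := R_CompleteNormedModule) F f); auto.
Qed.

Lemma RInt_subst (f g dg : R -> R) (a b : R) :
  (forall x, continuous f x) -> (forall x, is_derive g x (dg x)) ->
  (forall x, continuous dg x) ->
  RInt (fun x => dg x * f (g x)) a b = RInt f (g a) (g b).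
Proof. intros. apply (RInt_comp f g dg a b); auto. Qed.

Lemma continuous_RInt_param (f : R -> R -> R) (a b : R) :
  continuous2 f -> forall x, continuous (fun x => RInt (f x) a b) x.
Proof.
  intros Hf.
  assert (Hfx : forall x y, continuous (f x) y).
  { intros x y. apply (cont_comp2 f (fun _ => x) (fun y => y)); cont; auto. }
  assert (Hab : forall a b, a <= b -> forall x, continuous (fun x => RInt (f x) a b) x).
  { clear a b; intros a b Hab x.
    apply continuity_pt_filterlim, continuity_pt_locally. intros eps.
    (* The [+ 1] keeps the quotient defined when a = b and makes the resulting bound on the integral
       strictly smaller than eps. *)
    assert (He : 0 < eps / (b - a + 1)) by (apply Rdiv_lt_0_compat; [apply cond_pos|lra]).
    destruct (uniform_continuity_2d_1d' f a b x
      (fun y _ => continuous2_pt f Hf x y) (mkposreal _ He)) as [d Hd].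
    exists d. intros u Hu. simpl in Hd.
    assert (Hu' : Rabs (u - x) < d) by exact Hu. apply Rabs_def2 in Hu'.
    rewrite <- RInt_sub by auto.
    eapply Rle_lt_trans.
    - apply (abs_RInt_le_const _ a b (eps / (b - a + 1))); auto.
      + apply ex_RInt_cont. intros y. apply cont_minus; auto.
      + intros t Ht. apply Rlt_le.
        pose proof (cond_pos d).
        apply (Hd t x t u); try lra. rewrite Rminus_diag, Rabs_R0; lra.
    - pose proof (cond_pos eps).
      apply (Rmult_lt_reg_r (b - a + 1)); [lra|]. field_simplify; [|lra]. nra. }
  intros x. destruct (Rle_dec a b) as [H|H]; [auto|].
  apply (continuous_ext (fun x => - RInt (f x) b a)).
  - intros t. apply (opp_RInt_swap (f t) b a), ex_RInt_cont; auto.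
  - apply cont_opp, Hab. lra.
Qed.

Lemma continuous2_swap (f : R -> R -> R) :
  continuous2 f -> continuous2 (fun x y => f y x).
Proof. intros H x y. cont. Qed.

Lemma continuous2_l (f : R -> R -> R) (y x : R) :
  continuous2 f -> continuous (fun x => f x y) x.
Proof. intros H. cont. Qed.

Lemma continuous2_r (f : R -> R -> R) (x y : R) :
  continuous2 f -> continuous (fun y => f x y) y.
Proof. intros H. cont. Qed.

Lemma is_derive_RInt_cont (f : R -> R) (a x : R) :
  (forall x, continuous f x) -> is_derive (fun x => RInt f a x) x (f x).
Proof.
  intros H. apply (is_derive_RInt f _ a); auto.
  apply filter_forall. intros y.
  apply (RInt_correct (V := R_CompleteNormedModule)), ex_RInt_cont; auto.
Qed.

(** As functions of the upper end b both sides vanish at b = a and have the same derivative; the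
    right side is differentiated under the integral sign. *)
Lemma Fubini_continuous (f : R -> R -> R) (a b c d : R) :
  continuous2 f -> a < b ->
  RInt (fun x => RInt (fun y => f x y) c d) a b =
  RInt (fun y => RInt (fun x => f x y) a b) c d.
Proof.
  intros Hf Hab.
  set (G := fun t => RInt (fun x => RInt (fun y => f x y) c d) a t -
                     RInt (fun y => RInt (fun x => f x y) a t) c d).
  assert (Hd : forall t y, is_derive (fun t => RInt (fun x => f x y) a t) t (f t y)).
  { intros t y. apply (is_derive_RInt_cont (fun x => f x y)).
    intros x; now apply continuous2_l. }
  assert (HG : G a = G b).
  { apply (eq_is_derive G); auto. intros t _. unfold G.
    replace (@zero R_NormedModule) with
      (minus (RInt (fun y => f t y) c d) (RInt (fun y => f t y) c d))
      by apply (minus_eq_zero (G := R_AbelianGroup)).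
    apply (is_derive_minus (V := R_NormedModule)).
    - apply (is_derive_RInt_cont (fun x => RInt (fun y => f x y) c d)).
      apply continuous_RInt_param; auto.
    - replace (RInt (fun y => f t y) c d) with
        (RInt (fun y => Derive (fun u => RInt (fun x => f x y) a u) t) c d).
      2:{ apply RInt_ext. intros y _. apply is_derive_unique, Hd. }
      apply (is_derive_RInt_param (fun t y => RInt (fun x => f x y) a t) c d).
      + apply filter_forall. intros s y _. eexists; apply Hd.
      + intros y _. apply (continuity_2d_pt_ext f).
        * intros u v. symmetry. apply is_derive_unique, Hd.
        * now apply continuous2_pt.
      + apply filter_forall. intros s. apply ex_RInt_cont.
        apply (continuous_RInt_param (fun y x => f x y)), continuous2_swap, Hf. }
  unfold G in HG. rewrite RInt_point in HG.
  replace (RInt (fun y => RInt (fun x => f x y) a a) c d) with 0 in HG.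
  - change (0 - 0 = RInt (fun x => RInt (fun y => f x y) c d) a b -
                     RInt (fun y => RInt (fun x => f x y) a b) c d) in HG. lra.
  - rewrite (RInt_ext _ (fun _ => 0)).
    + rewrite RInt_cst. ring.
    + intros; apply (RInt_point a (fun x0 => f x0 x)).
Qed.

Lemma RInt_cont_eq0 (g : R -> R) (a b : R) :
  a < b -> (forall x, continuous g x) -> (forall x, 0 <= g x) ->
  RInt g a b <= 0 -> forall x, a <= x <= b -> g x = 0.
Proof.
  intros Hab Hc Hp HI x Hx.
  destruct (Rle_lt_or_eq_dec 0 (g x) (Hp x)) as [Hg|Hg]; [exfalso|auto].
  assert (Hl : locally x (fun y => 0 < g y)).
  { apply (Hc x (fun z => 0 < z)). apply open_gt. exact Hg. }
  destruct Hl as [e He]. pose proof (cond_pos e).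
  set (c := Rmax a (x - e / 2)). set (d := Rmin b (x + e / 2)).
  assert (a <= c) by apply Rmax_l. assert (d <= b) by apply Rmin_l.
  assert (x - e / 2 <= c) by apply Rmax_r. assert (d <= x + e / 2) by apply Rmin_r.
  assert (c < d).
  { unfold c, d, Rmax, Rmin; destruct Rle_dec; destruct Rle_dec; lra. }
  assert (He1 : forall u v, ex_RInt g u v) by (intros; apply ex_RInt_cont; auto).
  assert (0 < RInt g c d).
  { apply RInt_gt_0; auto. intros y Hy. apply He.
    change (Rabs (y - x) < e). apply Rabs_def1; lra. }
  assert (0 <= RInt g a c) by (apply RInt_ge_0; auto).
  assert (0 <= RInt g d b) by (apply RInt_ge_0; auto).
  rewrite (RInt_split g a c b), (RInt_split g c d b) in HI by auto. lra.
Qed.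

(* In the compactness argument the radius at each point is also bounded by
   half the value there, so that the Lebesgue number is itself the bound. *)
Lemma continuous2_pos_min (f : R -> R -> R) (a b c d : R) :
  continuous2 f -> (forall x y, 0 < f x y) ->
  exists m, 0 < m /\ forall x y, a <= x <= b -> c <= y <= d -> m <= f x y.
Proof.
  intros Hf Hp.
  assert (Hdel : forall u v, {e : posreal | e <= f u v / 2 /\ forall x y,
     Rabs (x - u) < e -> Rabs (y - v) < e -> f u v / 2 <= f x y}).
  { intros u v.
    assert (H2 : 0 < f u v / 2) by (specialize (Hp u v); lra).
    destruct (locally_2d_ex_dec (fun x y => f u v / 2 <= f x y) u v) as [e He].
    - intros x y; destruct (Rle_dec (f u v / 2) (f x y)); auto.
    - destruct (continuous2_pt f Hf u v (mkposreal _ H2)) as [e He].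
      exists e. intros x y Hx Hy. specialize (He x y Hx Hy). simpl in He.
      apply Rabs_def2 in He. lra.
    - assert (Hm : 0 < Rmin e (f u v / 2)) by (apply Rmin_pos; [apply cond_pos|auto]).
      exists (mkposreal _ Hm). simpl. split; [apply Rmin_r|].
      intros x y Hx Hy. pose proof (Rmin_l e (f u v / 2)).
      apply He; lra. }
  destruct (compactness_value_2d a b c d (fun u v => proj1_sig (Hdel u v))) as [m Hm].
  exists m. split; [apply cond_pos|]. intros x y Hx Hy.
  apply Rnot_lt_le. intros Hlt. apply (Hm x y Hx Hy).
  intros (u & v & _ & _ & Hu & Hv & Hle).
  destruct (Hdel u v) as [e [He1 He2]]; simpl in *.
  specialize (He2 x y Hu Hv). lra.
Qed.

(** * Uniform approximation by polynomials *)

(* Expectation of [g] at the n-th step of a walk on the naturals that steps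
   up with probability [z]: [bernstein n (fun k => f (k / n)) z] is the n-th
   Bernstein polynomial of [f] at [z]. *)
Fixpoint bernstein (n : nat) (g : nat -> R) (z : R) : R :=
  match n with
  | O => g O
  | S m => (1 - z) * bernstein m g z + z * bernstein m (fun k => g (S k)) z
  end.

Lemma bernstein_le (n : nat) (g h : nat -> R) (z : R) :
  0 <= z <= 1 -> (forall k, (k <= n)%nat -> g k <= h k) ->
  bernstein n g z <= bernstein n h z.
Proof.
  intros Hz; revert g h; induction n as [|n IH]; intros g h H; simpl.
  - apply H; lia.
  - apply Rplus_le_compat; apply Rmult_le_compat_l; try lra; apply IH;
      intros; apply H; lia.
Qed.

Lemma bernstein_affine (n : nat) (g : nat -> R) (a b z : R) :
  bernstein n (fun k => a + b * g k) z = a + b * bernstein n g z.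
Proof.
  revert g; induction n as [|n IH]; intros g; simpl; [ring|].
  rewrite IH, (IH (fun k => g (S k))). ring.
Qed.

(** The walk has mean n z and variance n z (1 - z) after n steps. The centre [c] is left free
    because a step up replaces it by c - 1 in the induction. *)
Lemma bernstein_variance (n : nat) (c z : R) :
  bernstein n (fun k => (INR k - c) ^ 2) z = INR n * z * (1 - z) + (INR n * z - c) ^ 2.
Proof.
  revert c; induction n as [|n IH]; intros c.
  - simpl; ring.
  - cbn [bernstein]. rewrite IH.
    replace (bernstein n (fun k => (INR (S k) - c) ^ 2) z)
      with (bernstein n (fun k => (INR k - (c - 1)) ^ 2) z).
    + rewrite IH, S_INR. ring.
    + clear IH. assert (He : forall g h, (forall k, g k = h k) ->
        bernstein n g z = bernstein n h z).
      { induction n as [|n IH]; intros g h H; simpl; auto.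
        rewrite (IH g h H), (IH (fun k => g (S k)) (fun k => h (S k))); auto. }
      apply He. intros k. rewrite S_INR. ring.
Qed.

Lemma bernstein_approx (f : R -> R) (eps : R) :
  (forall x, continuous f x) -> 0 < eps ->
  exists n g, forall z, 0 <= z <= 1 -> Rabs (f z - bernstein n g z) <= eps.
Proof.
  intros Hf He.
  assert (Hc : forall x, 0 <= x <= 1 -> continuity_pt f x)
    by (intros; apply continuity_pt_filterlim, Hf).
  destruct (continuity_ab_maj (fun x => Rabs (f x)) 0 1 Rle_0_1) as [xM [HM _]].
  { intros; apply continuity_pt_filterlim.
    apply (cont_comp Rabs); [apply continuous_Rabs|apply Hf]. }
  set (M := Rabs (f xM)) in *.
  assert (HM0 : 0 <= M) by apply Rabs_pos.
  assert (He2 : 0 < eps / 2) by lra.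
  destruct (Heine_cor1 Rlt_0_1 Hc (mkposreal _ He2)) as [d [_ Hd]].
  simpl in Hd. pose proof (cond_pos d) as Hdp.
  (* Chebyshev's splitting: if |x - y| < d, uniform continuity gives eps / 2; otherwise (x - y)^2 /
     d^2 >= 1 pays for the crude bound 2 M. *)
  assert (Hd1 : forall x y, 0 <= x <= 1 -> 0 <= y <= 1 ->
     Rabs (f x - f y) <= eps / 2 + 2 * M / d ^ 2 * (x - y) ^ 2).
  { intros x y Hx Hy.
    assert (Hd2 : 0 < d ^ 2) by nra.
    destruct (Rlt_dec (Rabs (x - y)) d) as [Hlt|Hge].
    - specialize (Hd x y Hx Hy Hlt).
      assert (0 <= 2 * M / d ^ 2 * (x - y) ^ 2).
      { apply Rmult_le_pos; [|apply pow2_ge_0].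
        apply Rdiv_le_0_compat; lra. }
      lra.
    - assert (Hq : 1 <= (x - y) ^ 2 / d ^ 2).
      { apply Rle_div_r; auto. rewrite Rmult_1_l, <- (pow2_abs (x - y)).
        apply pow_incr; lra. }
      assert (Rabs (f x - f y) <= 2 * M).
      { eapply Rle_trans; [apply Rabs_triang|]. rewrite Rabs_Ropp.
        pose proof (HM x Hx); pose proof (HM y Hy). lra. }
      replace (2 * M / d ^ 2 * (x - y) ^ 2) with
        (2 * M * ((x - y) ^ 2 / d ^ 2)) by (field; lra).
      nra. }
  set (C := 2 * M / d ^ 2) in *.
  assert (HC : 0 <= C) by (apply Rdiv_le_0_compat; nra).
  (* The degree exceeds C / eps, so that the variance term C / n^2 * (n / 4) is at most eps / 4. *)
  destruct (nfloor_ex (C / eps)) as [n0 [_ Hn0]].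
  { apply Rdiv_le_0_compat; lra. }
  set (n := S n0). assert (Hn : 0 < INR n) by (apply lt_0_INR; lia).
  assert (HnC : C / INR n <= eps).
  { apply Rle_div_l; auto. apply Rmult_lt_compat_r with (r := eps) in Hn0; auto.
    unfold Rdiv in Hn0. rewrite Rmult_assoc, Rinv_l, Rmult_1_r in Hn0 by lra.
    unfold n. rewrite S_INR. lra. }
  exists n, (fun k => f (INR k / INR n)). intros z Hz.
  assert (Hk : forall k, (k <= n)%nat -> 0 <= INR k / INR n <= 1).
  { intros k Hk; split; [apply Rdiv_le_0_compat; auto; apply pos_INR|].
    apply Rle_div_l; auto. rewrite Rmult_1_l. now apply le_INR. }
  set (v := fun k => (INR k - INR n * z) ^ 2).
  assert (Hv : bernstein n v z <= INR n / 4).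
  { unfold v. rewrite bernstein_variance.
    replace (INR n * z - INR n * z) with 0 by ring.
    assert (z * (1 - z) <= 1 / 4) by (pose proof (pow2_ge_0 (z - 1 / 2)); lra).
    apply Rmult_le_compat_l with (r := INR n) in H; lra. }
  assert (Hpt : forall k, (k <= n)%nat ->
    Rabs (f (INR k / INR n) - f z) <= eps / 2 + C / INR n ^ 2 * v k).
  { intros k Hk'. eapply Rle_trans; [apply Hd1; auto|].
    apply Req_le. unfold v. field. lra. }
  assert (Hb : C / INR n ^ 2 * bernstein n v z <= eps / 4).
  { apply Rle_trans with (C / INR n ^ 2 * (INR n / 4)).
    - apply Rmult_le_compat_l; auto. apply Rdiv_le_0_compat; nra.
    - replace (C / INR n ^ 2 * (INR n / 4)) with (C / INR n / 4) by (field; lra).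
      lra. }
  assert (H1 : bernstein n (fun k => f (INR k / INR n)) z <=
     (f z + eps / 2) + C / INR n ^ 2 * bernstein n v z).
  { rewrite <- bernstein_affine. apply bernstein_le; auto.
    intros k Hk'. specialize (Hpt k Hk'). apply Rabs_le_between in Hpt. lra. }
  assert (H2 : (f z - eps / 2) + - (C / INR n ^ 2) * bernstein n v z <=
     bernstein n (fun k => f (INR k / INR n)) z).
  { rewrite <- bernstein_affine. apply bernstein_le; auto.
    intros k Hk'. specialize (Hpt k Hk'). apply Rabs_le_between in Hpt. lra. }
  apply Rabs_le. lra.
Qed.

(** * An Abel-type integral identity *)

Definition wallis (n : nat) : R := RInt (fun u => sin u ^ n) 0 PI.

(** Integration by parts: - cos u * sin u ^ (n + 1) vanishes at 0 and PI, and its derivative is the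
    difference of the two integrands. *)
Lemma wallis_rec (n : nat) : INR (n + 2) * wallis (n + 2) = INR (n + 1) * wallis n.
Proof.
  assert (H : RInt (fun u => INR (n + 2) * sin u ^ (n + 2) - INR (n + 1) * sin u ^ n) 0 PI
     = - cos PI * sin PI ^ (n + 1) - - cos 0 * sin 0 ^ (n + 1)).
  { apply (RInt_antiderivative (fun u => - cos u * sin u ^ (n + 1))).
    - intros x. auto_derive; auto.
      replace (Init.Nat.pred (n + 1)) with n by lia.
      rewrite !plus_INR, !pow_add. simpl INR.
      pose proof (sin2_cos2 x) as Hs. unfold Rsqr in Hs.
      transitivity (sin x * sin x * sin x ^ n -
        (INR n + 1) * sin x ^ n * (cos x * cos x)); [simpl; ring|].
      replace (cos x * cos x) with (1 - sin x * sin x) by lra. simpl. ring.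
    - intros x; cont. }
  rewrite sin_0, sin_PI, !pow_i in H by lia.
  rewrite RInt_sub, !RInt_mulc in H by (intros; cont).
  fold (wallis (n + 2)) (wallis n) in H. lra.
Qed.

Lemma wallis_0 : wallis 0 = PI.
Proof.
  unfold wallis. simpl. rewrite RInt_cst. ring.
Qed.

Lemma wallis_1 : wallis 1 = 2.
Proof.
  unfold wallis. rewrite (RInt_antiderivative (fun u => - cos u)).
  - rewrite cos_PI, cos_0. ring.
  - intros x. auto_derive; auto. ring.
  - intros; cont.
Qed.

(** By [wallis_rec] the product does not change with j. It supplies the constant term of the
    recursion in [abel_moments]. *)
Lemma wallis_prod (j : nat) : INR (2 * j + 1) * wallis (2 * j) * wallis (2 * j + 1) = 2 * PI.
Proof.
  induction j as [|j IH].
  - simpl (2 * 0)%nat. simpl (0 + 1)%nat. rewrite wallis_0, wallis_1. simpl. ring.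
  - pose proof (wallis_rec (2 * j)) as H1. pose proof (wallis_rec (2 * j + 1)) as H2.
    replace (2 * S j)%nat with (2 * j + 2)%nat by lia.
    replace (2 * j + 2 + 1)%nat with (2 * j + 1 + 2)%nat by lia.
    replace (2 * j + 1 + 1)%nat with (2 * j + 2)%nat in H2 by lia.
    rewrite <- IH.
    transitivity (wallis (2 * j + 2) * (INR (2 * j + 1 + 2) * wallis (2 * j + 1 + 2))); [ring|].
    rewrite H2.
    transitivity (INR (2 * j + 2) * wallis (2 * j + 2) * wallis (2 * j + 1)); [ring|].
    rewrite H1. ring.
Qed.

Section Abel.

Variable B : R.
Hypothesis HB : 0 < B.

Let k := sqrt (1 + B ^ 2).

Local Lemma k2 : k ^ 2 = 1 + B ^ 2.
Proof. unfold k. apply pow2_sqrt. nra. Qed.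

Local Lemma k_gt : B < k.
Proof.
  assert (0 <= k) by apply sqrt_pos. pose proof k2. nra.
Qed.

Local Lemma den_pos (x : R) : 0 < 1 + B ^ 2 * x ^ 2.
Proof. pose proof (pow2_ge_0 (B * x)). rewrite Rpow_mult_distr in H. lra. Qed.

Local Lemma den_neq (x : R) : 1 + B ^ 2 * x ^ 2 <> 0.
Proof. pose proof (den_pos x). lra. Qed.

Local Lemma sqrt_den_pos (x : R) : 0 < sqrt (1 + B ^ 2 * x ^ 2).
Proof. apply sqrt_lt_R0, den_pos. Qed.

Local Lemma sqrt_den_neq (x : R) : sqrt (1 + B ^ 2 * x ^ 2) <> 0.
Proof. pose proof (sqrt_den_pos x). lra. Qed.

Local Lemma den_neq_sqr (x : R) : 1 + (B * x) ^ 2 <> 0.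
Proof. pose proof (pow2_ge_0 (B * x)). lra. Qed.

Local Hint Resolve den_neq den_neq_sqr sqrt_den_neq : core.

(** For h w = w ^ j the two sides of [abel_identity] are [wallis (2 * j) * mA (2 * j)] and
    [2 * PI / k * mC (2 * j)]. *)
Let mA (n : nat) : R := RInt (fun t => sin t ^ (n + 1) / (1 + B ^ 2 * sin t ^ 2)) 0 PI.
Let mC (n : nat) : R := RInt (fun z => z ^ n / sqrt (1 + B ^ 2 * z ^ 2)) 0 1.

Local Lemma mA_rec (n : nat) : mA n + B ^ 2 * mA (n + 2) = wallis (n + 1).
Proof.
  unfold mA, wallis. rewrite <- RInt_mulc, <- RInt_add by (intros; cont; auto).
  apply RInt_ext. intros x _.
  replace (n + 2 + 1)%nat with (n + 1 + 2)%nat by lia. rewrite (pow_add _ (n + 1) 2).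
  as_R. field. auto.
Qed.

(** The combined integrand is the derivative of z ^ (n + 1) * sqrt (1 + B^2 z^2), which grows from 0
    to [k] on [0, 1]. *)
Local Lemma mC_rec (n : nat) :
  INR (n + 1) * mC n + INR (n + 2) * B ^ 2 * mC (n + 2) = k.
Proof.
  unfold mC. rewrite <- !RInt_mulc, <- RInt_add by (intros; cont; auto).
  rewrite (RInt_antiderivative (fun z => z ^ (n + 1) * sqrt (1 + B ^ 2 * z ^ 2))).
  - rewrite pow_i, !pow1 by lia. unfold k. rewrite Rmult_1_r. ring.
  - intros x. auto_derive.
    + rewrite Rmult_1_r. pose proof (den_pos x). simpl in *. lra.
    + replace (Init.Nat.pred (n + 1)) with n by lia.
      pose proof (sqrt_den_neq x) as Hs.
      assert (Hq : sqrt (1 + B ^ 2 * x ^ 2) ^ 2 = 1 + B ^ 2 * x ^ 2)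
        by (apply pow2_sqrt, Rlt_le, den_pos).
      replace (1 + B * (B * 1) * (x * (x * 1))) with (1 + B ^ 2 * x ^ 2) by ring.
      set (s := sqrt (1 + B ^ 2 * x ^ 2)) in *.
      rewrite !plus_INR, !pow_add. simpl INR.
      apply (Rmult_eq_reg_r s); auto. field_simplify; auto. rewrite Hq. ring.
  - intros x; cont; auto.
Qed.

(** Partial fractions in cos t, from 1 + B^2 sin^2 t = (k - B cos t) (k + B cos t). Since (k - B) (k
    + B) = 1, every logarithm reduces to that of k + B. *)
Local Lemma mA_0 : mA 0 = ln ((k + B) ^ 2) / (B * k).
Proof.
  pose proof k_gt as Hk. pose proof k2 as Hk2.
  unfold mA. simpl (0 + 1)%nat.
  set (F := fun t => (ln (k - B * cos t) - ln (k + B * cos t)) / (2 * B * k)).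
  rewrite (RInt_antiderivative F).
  - unfold F. rewrite cos_PI, cos_0.
    replace (k - B * -1) with (k + B) by ring.
    replace (k + B * -1) with (/ (k + B)).
    2:{ field_simplify_eq; [nra|lra]. }
    replace (k - B * 1) with (/ (k + B)).
    2:{ field_simplify_eq; [nra|lra]. }
    rewrite ln_Rinv, Rmult_1_r by lra.
    replace ((k + B) ^ 2) with ((k + B) * (k + B)) by ring.
    rewrite ln_mult by lra. field. lra.
  - intros x. unfold F. pose proof (COS_bound x).
    assert (0 < k - B * cos x) by nra. assert (0 < k + B * cos x) by nra.
    auto_derive; [repeat split; lra|].
    replace (1 + B ^ 2 * sin x ^ 2) with ((k - B * cos x) * (k + B * cos x)).
    2:{ pose proof (sin2_cos2 x) as Hs. unfold Rsqr in Hs.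
        transitivity (k ^ 2 - B ^ 2 * (cos x * cos x)); [ring|].
        rewrite Hk2. replace (cos x * cos x) with (1 - sin x * sin x) by lra. ring. }
    field. lra.
  - intros; cont; auto.
Qed.

Local Lemma mC_0 : mC 0 = ln (k + B) / B.
Proof.
  pose proof k_gt as Hk. unfold mC.
  rewrite (RInt_antiderivative (fun z => arcsinh (B * z) / B)).
  - rewrite Rmult_0_r, arcsinh_0, Rmult_1_r. unfold arcsinh.
    replace (sqrt (B ^ 2 + 1)) with k by (unfold k; f_equal; ring).
    rewrite (Rplus_comm B k). field. lra.
  - intros x.
    evar_last.
    { apply (is_derive_ext (fun z => / B * arcsinh (B * z))).
      { intros; unfold Rdiv; simpl; ring. }
      apply is_derive_scal.
      apply (is_derive_comp arcsinh (fun z => B * z)).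
      - apply is_derive_Reals, derivable_pt_lim_arcsinh.
      - auto_derive; auto. }
    unfold scal; simpl; unfold mult; simpl.
    replace (B * x * (B * x * 1) + 1) with (1 + B ^ 2 * x ^ 2) by ring.
    replace (1 + B * (B * 1) * (x * (x * 1))) with (1 + B ^ 2 * x ^ 2) by ring.
    field. split; [auto|lra].
  - intros; cont; auto.
Qed.

(** Both sides, written X_j, satisfy (2j + 2) B^2 X_(j+1) = 2 PI - (2j + 1) X_j: the left one by
    [mA_rec], [wallis_rec] and [wallis_prod], the right one by [mC_rec]. They agree at j = 0, where
    both are logarithms of k + B. *)
Local Lemma abel_moments (j : nat) : wallis (2 * j) * mA (2 * j) = 2 * PI / k * mC (2 * j).
Proof.
  pose proof k_gt as Hk.
  induction j as [|j IH].
  - simpl (2 * 0)%nat. rewrite wallis_0, mA_0, mC_0.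
    replace ((k + B) ^ 2) with ((k + B) * (k + B)) by ring.
    rewrite ln_mult by lra. field. lra.
  - replace (2 * S j)%nat with (2 * j + 2)%nat by lia.
    pose proof (mA_rec (2 * j)) as HA. pose proof (mC_rec (2 * j)) as HC.
    pose proof (wallis_rec (2 * j)) as HW. pose proof (wallis_prod j) as HP.
    assert (HI : 0 < INR (2 * j + 2)) by (apply lt_0_INR; lia).
    assert (0 < B ^ 2) by nra.
    apply (Rmult_eq_reg_l (INR (2 * j + 2) * B ^ 2)); [|nra].
    transitivity (INR (2 * j + 1) * wallis (2 * j) * (B ^ 2 * mA (2 * j + 2))).
    { rewrite <- HW. ring. }
    replace (B ^ 2 * mA (2 * j + 2)) with (wallis (2 * j + 1) - mA (2 * j)) by lra.
    transitivity (2 * PI - INR (2 * j + 1) * (wallis (2 * j) * mA (2 * j))).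
    { rewrite <- HP. ring. }
    rewrite IH.
    replace (INR (2 * j + 2) * B ^ 2 * (2 * PI / k * mC (2 * j + 2))) with
      (2 * PI / k * (INR (2 * j + 2) * B ^ 2 * mC (2 * j + 2))) by ring.
    replace (INR (2 * j + 2) * B ^ 2 * mC (2 * j + 2)) with
      (k - INR (2 * j + 1) * mC (2 * j)) by lra.
    field. lra.
Qed.

Let lhs (h : R -> R) : R :=
  RInt (fun t => sin t / (1 + B ^ 2 * sin t ^ 2) *
     RInt (fun u => h (sin t ^ 2 * sin u ^ 2)) 0 PI) 0 PI.
Let rhs (h : R -> R) : R :=
  2 * PI / k * RInt (fun z => h (z ^ 2) / sqrt (1 + B ^ 2 * z ^ 2)) 0 1.

Local Lemma inner_cont (h : R -> R) (x : R) : (forall y, continuous h y) ->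
  continuous (fun t => RInt (fun u => h (sin t ^ 2 * sin u ^ 2)) 0 PI) x.
Proof.
  intros Hh. apply (continuous_RInt_param (fun t u => h (sin t ^ 2 * sin u ^ 2))).
  intros t u. cont.
Qed.

Local Lemma lhs_lin (f g : R -> R) :
  (forall y, continuous f y) -> (forall y, continuous g y) ->
  lhs (fun w => f w - g w) = lhs f - lhs g.
Proof.
  intros Hf Hg. unfold lhs. rewrite <- RInt_sub.
  - apply RInt_ext. intros t _. rewrite RInt_sub; [|intros; cont ..].
    as_R. ring.
  - intros; cont; auto. now apply inner_cont.
  - intros; cont; auto. now apply inner_cont.
Qed.

Local Lemma rhs_lin (f g : R -> R) :
  (forall y, continuous f y) -> (forall y, continuous g y) ->
  rhs (fun w => f w - g w) = rhs f - rhs g.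
Proof.
  intros Hf Hg. unfold rhs. rewrite <- Rmult_minus_distr_l, <- RInt_sub.
  - f_equal. apply RInt_ext. intros t _.
    as_R. field. auto.
  - intros; cont; auto.
  - intros; cont; auto.
Qed.

(** A crude sup-norm bound suffices for the density argument: the weight is at most 1 in absolute
    value and both intervals have length PI. *)
Local Lemma lhs_bound (h : R -> R) (e : R) :
  (forall y, continuous h y) -> (forall z, 0 <= z <= 1 -> Rabs (h z) <= e) ->
  Rabs (lhs h) <= PI * (PI * e).
Proof.
  intros Hh He. pose proof PI_RGT_0. unfold lhs.
  assert (He0 : 0 <= e).
  { eapply Rle_trans; [apply Rabs_pos|apply (He 0)]; lra. }
  replace (PI * (PI * e)) with ((PI - 0) * (PI * e)) by ring.
  apply abs_RInt_le_const; [lra| |].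
  - apply ex_RInt_cont. intros; cont; auto. now apply inner_cont.
  - intros t Ht. rewrite Rabs_mult. rewrite <- (Rmult_1_l (PI * e)).
    apply Rmult_le_compat; try apply Rabs_pos.
    + rewrite Rabs_div, (Rabs_pos_eq (1 + _)) by (auto; apply Rlt_le, den_pos).
      apply Rle_div_l; [apply den_pos|].
      assert (Rabs (sin t) <= 1) by (apply Rabs_le, SIN_bound).
      pose proof (pow2_ge_0 (B * sin t)). rewrite Rpow_mult_distr in H1. lra.
    + replace (PI * e) with ((PI - 0) * e) by ring.
      apply abs_RInt_le_const; [lra| |].
      * apply ex_RInt_cont. intros; cont.
      * intros u _. apply He.
        pose proof (SIN_bound t); pose proof (SIN_bound u).
        assert (0 <= sin t ^ 2 <= 1) by nra. assert (0 <= sin u ^ 2 <= 1) by nra. nra.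
Qed.

Local Lemma rhs_bound (h : R -> R) (e : R) :
  (forall y, continuous h y) -> (forall z, 0 <= z <= 1 -> Rabs (h z) <= e) ->
  Rabs (rhs h) <= 2 * PI / k * e.
Proof.
  intros Hh He. pose proof PI_RGT_0. pose proof k_gt. unfold rhs.
  assert (Hpk : 0 < 2 * PI / k) by (apply Rdiv_lt_0_compat; lra).
  rewrite Rabs_mult, (Rabs_pos_eq (2 * PI / k)) by lra.
  apply Rmult_le_compat_l; [lra|].
  replace e with ((1 - 0) * e) by ring.
  apply abs_RInt_le_const; [lra| |].
  - apply ex_RInt_cont. intros; cont; auto.
  - intros z Hz. rewrite Rabs_div, (Rabs_pos_eq (sqrt _)) by (auto; apply sqrt_pos).
    apply Rle_div_l; [apply sqrt_den_pos|].
    assert (Hs : 1 <= sqrt (1 + B ^ 2 * z ^ 2)).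
    { rewrite <- sqrt_1 at 1. apply sqrt_le_1_alt.
      pose proof (pow2_ge_0 (B * z)). rewrite Rpow_mult_distr in H1. lra. }
    assert (Rabs (h (z ^ 2)) <= e) by (apply He; nra).
    pose proof (Rabs_pos (h (z ^ 2))). nra.
Qed.

Local Lemma abel_monomial (j : nat) (c : R) : lhs (fun w => w ^ j * c) = rhs (fun w => w ^ j * c).
Proof.
  unfold lhs, rhs.
  transitivity (c * (wallis (2 * j) * mA (2 * j))).
  - unfold mA. rewrite <- !RInt_mulc by (intros; cont; auto).
    apply RInt_ext. intros t _.
    rewrite (RInt_ext _ (fun u => (sin t ^ (2 * j) * c) * sin u ^ (2 * j))).
    + rewrite RInt_mulc by (intros; cont). fold (wallis (2 * j)).
      rewrite (pow_add _ (2 * j) 1). as_R. field. auto.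
    + intros u _. rewrite Rpow_mult_distr, <- !pow_mult.
      as_R. ring.
  - rewrite abel_moments. unfold mC.
    replace (c * (2 * PI / k * RInt (fun z => z ^ (2 * j) / sqrt (1 + B ^ 2 * z ^ 2)) 0 1))
      with (2 * PI / k * (c * RInt (fun z => z ^ (2 * j) / sqrt (1 + B ^ 2 * z ^ 2)) 0 1)) by ring.
    f_equal. rewrite <- RInt_mulc by (intros; cont; auto).
    apply RInt_ext. intros z _. rewrite <- pow_mult.
    as_R. field. auto.
Qed.

Local Lemma bernstein_cont (n : nat) (g : nat -> R) (x : R) : continuous (bernstein n g) x.
Proof.
  revert g; induction n as [|n IH]; intros g; simpl; cont; apply IH.
Qed.

(** The factor w ^ j makes the induction close, since a step of the recursion multiplies by w. The
    step (1 - w) P + w Q is written P - (w P - w Q), so that [lhs_lin] and [rhs_lin], which treat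
    differences only, are enough. *)
Local Lemma abel_bernstein (n : nat) (g : nat -> R) (j : nat) :
  lhs (fun w => w ^ j * bernstein n g w) = rhs (fun w => w ^ j * bernstein n g w).
Proof.
  revert g j; induction n as [|n IH]; intros g j.
  - exact (abel_monomial j (g O)).
  - assert (Hc : forall g i w, continuous (fun w => w ^ i * bernstein n g w) w)
      by (intros; cont; apply bernstein_cont).
    assert (E : forall F : (R -> R) -> R,
      (forall f g, (forall y, f y = g y) -> F f = F g) ->
      (forall f g, (forall y, continuous f y) -> (forall y, continuous g y) ->
         F (fun w => f w - g w) = F f - F g) ->
      F (fun w => w ^ j * bernstein (S n) g w) =
      F (fun w => w ^ j * bernstein n g w) -
      (F (fun w => w ^ (S j) * bernstein n g w) -
       F (fun w => w ^ (S j) * bernstein n (fun k => g (S k)) w))).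
    { intros F Hext Hlin. rewrite <- Hlin by auto. rewrite <- Hlin.
      - apply Hext. intros w. simpl. ring.
      - auto.
      - intros w. apply cont_minus; auto. }
    rewrite (E lhs), (E rhs), !IH; auto using lhs_lin, rhs_lin.
    + intros f f' H. unfold rhs. f_equal. apply RInt_ext. intros; now rewrite H.
    + intros f f' H. unfold lhs. apply RInt_ext. intros. f_equal.
      apply RInt_ext. intros; now rewrite H.
Qed.

(** Geometrically t selects the great circle with c = B sin t, u a point on it, and z = sin t sin u
    is sinh y / B at the height y of that point: averaging over circles becomes an integral over
    heights. *)
Lemma abel_identity (h : R -> R) : (forall y, continuous h y) ->
  RInt (fun t => sin t / (1 + B ^ 2 * sin t ^ 2) *
     RInt (fun u => h (sin t ^ 2 * sin u ^ 2)) 0 PI) 0 PI =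
  2 * PI / sqrt (1 + B ^ 2) *
     RInt (fun z => h (z ^ 2) / sqrt (1 + B ^ 2 * z ^ 2)) 0 1.
Proof.
  intros Hh. pose proof PI_RGT_0. pose proof k_gt.
  change (lhs h = rhs h).
  (* The sum of the sup-norm bounds of the two sides; an approximation within eps / (2 C) leaves an
     error of eps / 2. *)
  set (C := PI * PI + 2 * PI / k).
  assert (HC : 0 < C).
  { assert (0 < 2 * PI / k) by (apply Rdiv_lt_0_compat; lra). unfold C. nra. }
  apply cond_eq. intros eps Heps.
  assert (He : 0 < eps / (2 * C)) by (apply Rdiv_lt_0_compat; lra).
  destruct (bernstein_approx h _ Hh He) as (n & g & Hg).
  assert (Hb : forall y, continuous (bernstein n g) y) by (intros; apply bernstein_cont).
  assert (E : lhs (bernstein n g) = rhs (bernstein n g)).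
  { pose proof (abel_bernstein n g 0) as E0. unfold lhs, rhs in E0 |- *.
    simpl pow in E0.
    etransitivity; [|etransitivity; [apply E0|]].
    - apply RInt_ext. intros. f_equal. apply RInt_ext. intros. simpl. now rewrite Rmult_1_l.
    - f_equal. apply RInt_ext. intros. simpl. now rewrite Rmult_1_l. }
  assert (Hm : forall y, continuous (fun w => h w - bernstein n g w) y)
    by (intros; now apply cont_minus).
  pose proof (lhs_bound (fun w => h w - bernstein n g w) _ Hm Hg) as H1.
  pose proof (rhs_bound (fun w => h w - bernstein n g w) _ Hm Hg) as H2.
  rewrite lhs_lin in H1 by auto. rewrite rhs_lin in H2 by auto.
  replace (lhs h - rhs h) with
    ((lhs h - lhs (bernstein n g)) - (rhs h - rhs (bernstein n g))) by (rewrite E; ring).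
  eapply Rle_lt_trans; [apply Rabs_triang|]. rewrite Rabs_Ropp.
  assert (HCe : C * (eps / (2 * C)) = eps / 2) by (field; lra).
  unfold C in HCe at 1. nra.
Qed.

End Abel.

(** * Hyperbolic form of [phi0] and the average over great circles *)

Lemma is_derive_arcsinh (x : R) : is_derive arcsinh x (/ sqrt (1 + x ^ 2)).
Proof.
  rewrite Rplus_comm. apply is_derive_Reals, derivable_pt_lim_arcsinh.
Qed.

Lemma one_plus_sqr_pos (x : R) : 0 < 1 + x ^ 2.
Proof. pose proof (pow2_ge_0 x). lra. Qed.

Lemma sqrt_one_plus_sqr_neq0 (x : R) : sqrt (1 + x ^ 2) <> 0.
Proof. apply Rgt_not_eq, sqrt_lt_R0, one_plus_sqr_pos. Qed.

Lemma cosh_pos (x : R) : 0 < cosh x.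
Proof. unfold cosh. pose proof (exp_pos x). pose proof (exp_pos (- x)). lra. Qed.

Lemma cosh2_sinh2 (x : R) : cosh x ^ 2 = 1 + sinh x ^ 2.
Proof.
  unfold cosh, sinh.
  assert (exp x * exp (- x) = 1) by (rewrite <- exp_plus, Rplus_opp_r; apply exp_0).
  transitivity (exp x * exp (- x) + ((exp x - exp (- x)) / 2) ^ 2); [field|].
  rewrite H. reflexivity.
Qed.

Lemma sqrt_cosh (x : R) : sqrt (1 + sinh x ^ 2) = cosh x.
Proof. rewrite <- cosh2_sinh2. apply sqrt_pow2. apply Rlt_le, cosh_pos. Qed.

Lemma phi0_cosh (y : R) : phi0 y = / cosh y.
Proof.
  unfold phi0, cosh. replace (2 * y) with (y + y) by ring. rewrite exp_plus, exp_Ropp.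
  pose proof (exp_pos y). field. repeat split; nra.
Qed.

Lemma phi0_arcsinh (w : R) : phi0 (arcsinh w) = / sqrt (1 + w ^ 2).
Proof. rewrite phi0_cosh, <- sqrt_cosh, sinh_arcsinh. reflexivity. Qed.

Lemma cont_phi0 (y : R) : continuous phi0 y.
Proof.
  unfold phi0. cont. pose proof (exp_pos (2 * y)). lra.
Qed.

(** The total mass of the weight put on the circles in the variable t; it converts a lower bound
    common to all circles into a bound for their average. *)
Lemma great_circle_weight (B : R) :
  RInt (fun t => sin t / (sqrt (1 + (B * sin t) ^ 2) * (1 + B ^ 2 * sin t ^ 2))) 0 PI
  = 2 / (1 + B ^ 2).
Proof.
  set (q := fun t => sqrt (1 + (B * sin t) ^ 2)).
  assert (Hq : forall t, q t <> 0) by (intros; apply sqrt_one_plus_sqr_neq0).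
  assert (Hq2 : forall t, q t ^ 2 = 1 + B ^ 2 * sin t ^ 2).
  { intros t. unfold q. rewrite pow2_sqrt; [ring|]. apply Rlt_le, one_plus_sqr_pos. }
  pose proof (one_plus_sqr_pos B) as HB.
  rewrite (RInt_antiderivative (fun t => - cos t / ((1 + B ^ 2) * q t))).
  - unfold q. rewrite sin_PI, sin_0, cos_PI, cos_0, Rmult_0_r.
    replace (1 + 0 ^ 2) with 1 by ring. rewrite sqrt_1. as_R. field. lra.
  - intros t. fold (q t). rewrite <- Hq2. unfold q at 1.
    auto_derive.
    + pose proof (one_plus_sqr_pos (B * sin t)) as Hp.
      pose proof (sqrt_one_plus_sqr_neq0 (B * sin t)) as Hs.
      simpl in Hp, Hs, HB. repeat split; auto.
      apply Rmult_integral_contrapositive; split; auto. lra.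
    + replace (1 + B * sin t * (B * sin t * 1)) with (1 + (B * sin t) ^ 2) by ring.
      fold (q t). specialize (Hq t). specialize (Hq2 t).
      replace (B * (B * 1)) with (B ^ 2) by ring.
      pose proof (sin2_cos2 t) as Hs. unfold Rsqr in Hs.
      transitivity (sin t * (q t ^ 2 + B ^ 2 * (cos t * cos t)) / ((1 + B ^ 2) * q t ^ 3)).
      { field. repeat split; auto; lra. }
      replace (q t ^ 2 + B ^ 2 * (cos t * cos t)) with (1 + B ^ 2).
      2:{ rewrite Hq2. replace (cos t * cos t) with (1 - sin t * sin t) by lra. ring. }
      field. repeat split; auto; lra.
  - intros t. fold (q t). cont.
    + apply Rgt_not_eq. apply Rlt_gt. unfold Rsqr.
      apply Rmult_lt_0_compat; [apply sqrt_lt_R0, one_plus_sqr_pos|].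
      rewrite <- Hq2. apply pow2_gt_0, Hq.
Qed.

(* The average over rotations of the length of the great circles
   [sinh y = c sin x], [0 <= c <= sinh b], integrated against the density
   [c / ((1 + c^2)^(3/2) sqrt (sinh b ^ 2 - c^2))]; after [c = sinh b * sin t] the
   singularity disappears and [abel_identity] applies. *)
Lemma great_circles_average (Psi : R -> R) (b s : R) :
  0 < b -> (forall y, continuous Psi y) ->
  (forall c, 0 <= c <= sinh b ->
    2 * PI * s <= sqrt (1 + c ^ 2) *
       RInt (fun u => Psi (arcsinh (c * sin u)) / sqrt (1 + (c * sin u) ^ 2)) 0 PI) ->
  2 * s * (sinh b / cosh b) <= RInt (fun y => Psi y * phi0 y) 0 b.
Proof.
  intros Hb HPsi Hc.
  set (B := sinh b) in *.
  assert (HB : 0 < B) by (unfold B; rewrite <- sinh_0; now apply sinh_lt).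
  assert (Hk : sqrt (1 + B ^ 2) = cosh b) by apply sqrt_cosh.
  pose proof (cosh_pos b) as Hcp. pose proof PI_RGT_0 as Hpi.
  (* The argument w stands for (sin t sin u)^2. Both sines are nonnegative on [0, PI], hence B sqrt
     w = c sin u with c = B sin t. *)
  set (h := fun w => Psi (arcsinh (B * sqrt w)) / sqrt (1 + (B * sqrt w) ^ 2)).
  assert (Hh : forall y, continuous h y).
  { intros y. unfold h. cont. apply sqrt_one_plus_sqr_neq0. }
  pose proof (abel_identity B HB h Hh) as E. rewrite Hk in E.
  assert (Hden : forall x, 0 < 1 + B ^ 2 * x ^ 2).
  { intros x. rewrite <- Rpow_mult_distr. apply one_plus_sqr_pos. }
  (* Substitution sinh y = B z: one factor 1 / sqrt (1 + B^2 z^2) is absorbed in dy, the other one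
     is [phi0 y]. *)
  assert (ER : B * RInt (fun z => h (z ^ 2) / sqrt (1 + B ^ 2 * z ^ 2)) 0 1 =
     RInt (fun y => Psi y * phi0 y) 0 b).
  { rewrite <- RInt_mulc.
    2:{ intros; cont. apply Rgt_not_eq, sqrt_lt_R0, Hden. }
    transitivity (RInt (fun y => Psi y * phi0 y) (arcsinh (B * 0)) (arcsinh (B * 1))).
    2:{ rewrite Rmult_0_r, arcsinh_0, Rmult_1_r. unfold B. now rewrite arcsinh_sinh. }
    rewrite <- (RInt_subst (fun y => Psi y * phi0 y) (fun z => arcsinh (B * z))
                  (fun z => B * / sqrt (1 + (B * z) ^ 2))).
    - apply RInt_ext. intros z Hz. rewrite Rmin_left, Rmax_right in Hz by lra.
      unfold h. rewrite sqrt_pow2 by lra. rewrite phi0_arcsinh.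
      rewrite <- Rpow_mult_distr. as_R. field. apply sqrt_one_plus_sqr_neq0.
    - intros y. cont. apply cont_phi0.
    - intros z.
      apply (is_derive_comp arcsinh (fun z => B * z)).
      + apply is_derive_arcsinh.
      + auto_derive; auto. ring.
    - intros z. cont. apply sqrt_one_plus_sqr_neq0. }
  assert (EL : 2 * PI * s * (2 / (1 + B ^ 2)) <=
    RInt (fun t => sin t / (1 + B ^ 2 * sin t ^ 2) *
     RInt (fun u => h (sin t ^ 2 * sin u ^ 2)) 0 PI) 0 PI).
  { assert (Hc0 : forall t, sqrt (1 + (B * sin t) ^ 2) * (1 + B ^ 2 * sin t ^ 2) <> 0).
    { intros t. apply Rmult_integral_contrapositive. split.
      - apply sqrt_one_plus_sqr_neq0.
      - apply Rgt_not_eq, Hden. }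
    rewrite <- great_circle_weight, <- RInt_mulc by (intros; cont; apply Hc0).
    apply RInt_mono.
    - intros; cont. apply Hc0.
    - intros; cont. apply Rgt_not_eq, Hden.
      apply (continuous_RInt_param (fun t u => h (sin t ^ 2 * sin u ^ 2))).
      intros t u. cont.
    - lra.
    - intros t Ht.
      assert (Hst : 0 <= sin t <= 1) by (split; [apply sin_ge_0; lra|apply SIN_bound]).
      specialize (Hc (B * sin t)).
      assert (Hr : 0 <= B * sin t <= B) by nra. specialize (Hc Hr).
      rewrite (RInt_ext (fun u => h (sin t ^ 2 * sin u ^ 2))
        (fun u => Psi (arcsinh (B * sin t * sin u)) / sqrt (1 + (B * sin t * sin u) ^ 2))).
      2:{ intros u Hu. rewrite Rmin_left, Rmax_right in Hu by lra.
          assert (0 <= sin u) by (apply sin_ge_0; lra).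
          unfold h. rewrite <- Rpow_mult_distr, sqrt_pow2 by nra.
          now rewrite <- Rmult_assoc. }
      set (I := RInt _ _ _) in *.
      pose proof (Hden (sin t)) as Hd.
      pose proof (sqrt_lt_R0 _ (one_plus_sqr_pos (B * sin t))) as Hs.
      set (q := sqrt (1 + (B * sin t) ^ 2)) in *.
      replace (2 * PI * s * (sin t / (q * (1 + B ^ 2 * sin t ^ 2)))) with
        (sin t / (1 + B ^ 2 * sin t ^ 2) * (2 * PI * s / q)).
      2:{ field. split; [|apply Rgt_not_eq, Hs].
          replace (1 + (B * sin t) ^ 2) with (1 + B ^ 2 * sin t ^ 2) by ring. lra. }
      apply Rmult_le_compat_l.
      + apply Rdiv_le_0_compat; lra.
      + apply Rle_div_l; auto. rewrite (Rmult_comm I). exact Hc. }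
  rewrite E in EL. rewrite <- ER.
  set (J := RInt (fun z => h (z ^ 2) / sqrt (1 + B ^ 2 * z ^ 2)) 0 1) in *.
  change (RInt (fun z => h (z ^ 2) / sqrt (1 + B ^ 2 * z ^ 2)) 0 1) with J in EL.
  assert (Hk2 : 1 + B ^ 2 = cosh b ^ 2) by (rewrite cosh2_sinh2; reflexivity).
  rewrite Hk2 in EL.
  replace (2 * s * (B / cosh b)) with
    (B * cosh b / (2 * PI) * (2 * PI * s * (2 / cosh b ^ 2))) by (field; lra).
  replace (B * J) with (B * cosh b / (2 * PI) * (2 * PI / cosh b * J)) by (field; lra).
  apply Rmult_le_compat_l; auto.
  apply Rdiv_le_0_compat; nra.
Qed.

(** * Lengths and systoles *)

(** [real] sends infinite values to 0, so a lower bound and a member of the set are what makes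
    [real (Glb_Rbar E)] a genuine infimum. *)
Lemma real_Glb_Rbar (E : R -> Prop) (m x0 : R) :
  (forall x, E x -> m <= x) -> E x0 ->
  m <= real (Glb_Rbar E) /\ forall x, E x -> real (Glb_Rbar E) <= x.
Proof.
  intros Hm Hx0. destruct (Glb_Rbar_correct E) as [Hlb Hglb].
  assert (Hl : Rbar_le m (Glb_Rbar E)) by (apply Hglb; intros x Hx; apply Hm, Hx).
  pose proof (Hlb x0 Hx0) as Hu.
  destruct (Glb_Rbar E) as [g| |]; simpl in *; try contradiction.
  split; auto.
Qed.

Lemma nc_derivable (beta : R) (gx gy : R -> R) (k : Z) (t : R) :
  nc_closed_curve beta gx gy k -> ex_derive gx t /\ ex_derive gy t.
Proof. intros (_ & H & _). exact (H t). Qed.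

Lemma nc_C1 (beta : R) (gx gy : R -> R) (k : Z) (t : R) :
  nc_closed_curve beta gx gy k -> 0 <= t <= 1 ->
  continuous (Derive gx) t /\ continuous (Derive gy) t.
Proof. intros (_ & _ & H & _) Ht. destruct (H t Ht) as (Hx & Hy & _). now split. Qed.

Lemma nc_in_strip (beta : R) (gx gy : R -> R) (k : Z) (t : R) :
  nc_closed_curve beta gx gy k -> 0 <= t <= 1 -> in_strip beta (gx t) (gy t).
Proof. intros (_ & _ & H & _) Ht. exact (proj2 (proj2 (H t Ht))). Qed.

Lemma speed_cont (gx gy : R -> R) (t : R) :
  continuous (Derive gx) t -> continuous (Derive gy) t ->
  continuous (fun t => sqrt (Derive gx t ^ 2 + Derive gy t ^ 2)) t.
Proof. intros Hx Hy. cont; assumption. Qed.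

Lemma length_integrand_cont (beta : R) (psi : R -> R -> R) (gx gy : R -> R) (k : Z) (t : R) :
  continuous2 psi -> nc_closed_curve beta gx gy k -> 0 <= t <= 1 ->
  continuous (fun t => psi (gx t) (gy t) * sqrt (Derive gx t ^ 2 + Derive gy t ^ 2)) t.
Proof.
  intros Hpsi Hg Ht. destruct (nc_C1 _ _ _ _ t Hg Ht) as [Hx Hy].
  destruct (nc_derivable _ _ _ _ t Hg) as [Hdx Hdy].
  apply cont_mult; [|now apply speed_cont].
  apply cont_comp2; auto;
    apply (ex_derive_continuous (K := R_AbsRing) (V := R_NormedModule)); auto.
Qed.

Lemma ex_RInt_length (beta : R) (psi : R -> R -> R) (gx gy : R -> R) (k : Z) :
  continuous2 psi -> nc_closed_curve beta gx gy k ->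
  ex_RInt (fun t => psi (gx t) (gy t) * sqrt (Derive gx t ^ 2 + Derive gy t ^ 2)) 0 1.
Proof.
  intros Hpsi Hg. apply (ex_RInt_continuous (V := R_CompleteNormedModule)).
  intros t Ht. rewrite Rmin_left, Rmax_right in Ht by lra.
  eapply length_integrand_cont; eauto.
Qed.

Lemma curve_length_nonneg (beta : R) (psi : R -> R -> R) (gx gy : R -> R) (k : Z) :
  continuous2 psi -> (forall x y, in_strip beta x y -> 0 <= psi x y) ->
  nc_closed_curve beta gx gy k -> 0 <= curve_length psi gx gy.
Proof.
  intros Hpsi Hp Hg. apply RInt_ge_0; [lra|eapply ex_RInt_length; eauto|].
  intros t Ht. apply Rmult_le_pos; [|apply sqrt_pos].
  apply Hp. eapply nc_in_strip; [eauto|lra].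
Qed.

(** The source of all lower bounds on lengths: a function along the curve that grows no faster than
    arc length. It is used with multiples of x for winding and with an arcsine for the sphere. *)
Lemma curve_length_calibration (beta : R) (psi : R -> R -> R) (gx gy : R -> R) (k : Z)
    (G dG : R -> R) :
  continuous2 psi -> nc_closed_curve beta gx gy k ->
  (forall t, 0 <= t <= 1 -> is_derive G t (dG t)) ->
  (forall t, 0 <= t <= 1 -> continuous dG t) ->
  (forall t, 0 <= t <= 1 ->
     dG t <= psi (gx t) (gy t) * sqrt (Derive gx t ^ 2 + Derive gy t ^ 2)) ->
  G 1 - G 0 <= curve_length psi gx gy.
Proof.
  intros Hpsi Hg HG HdG Hle.
  assert (HI : is_RInt dG 0 1 (G 1 - G 0)).
  { apply (is_RInt_derive (V := R_CompleteNormedModule) G dG);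
      intros t Ht; rewrite Rmin_left, Rmax_right in Ht by lra; auto. }
  rewrite <- (is_RInt_unique _ _ _ _ HI). apply RInt_le; [lra|eexists; eauto| |].
  - eapply ex_RInt_length; eauto.
  - intros t Ht. apply Hle. lra.
Qed.

Lemma abs_le_speed (a b : R) : Rabs a <= sqrt (a ^ 2 + b ^ 2).
Proof.
  rewrite <- (sqrt_pow2 (Rabs a)) by apply Rabs_pos. rewrite pow2_abs.
  apply sqrt_le_1_alt. pose proof (pow2_ge_0 b). lra.
Qed.

Lemma curve_length_winding (beta m : R) (psi : R -> R -> R) (gx gy : R -> R) (k : Z) :
  continuous2 psi -> 0 <= m -> (forall x y, in_strip beta x y -> m <= psi x y) ->
  nc_closed_curve beta gx gy k -> m * (IZR (Z.abs k) * PI) <= curve_length psi gx gy.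
Proof.
  intros Hpsi Hm Hp Hg.
  (* [e] will be the sign of [k]. *)
  assert (HG : forall e, -1 <= e <= 1 -> m * e * gx 1 - m * e * gx 0 <= curve_length psi gx gy).
  { intros e He.
    apply (curve_length_calibration beta psi gx gy k (fun t => m * e * gx t)
             (fun t => m * e * Derive gx t)); auto.
    - intros t _. apply is_derive_scal, Derive_correct. exact (proj1 (nc_derivable _ _ _ _ t Hg)).
    - intros t Ht. cont. exact (proj1 (nc_C1 _ _ _ _ t Hg Ht)).
    - intros t Ht. rewrite Rmult_assoc.
      assert (Hs : e * Derive gx t <= sqrt (Derive gx t ^ 2 + Derive gy t ^ 2)).
      { eapply Rle_trans; [|apply abs_le_speed].
        eapply Rle_trans; [apply Rle_abs|]. rewrite Rabs_mult.
        rewrite <- (Rmult_1_l (Rabs (Derive gx t))) at 2.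
        apply Rmult_le_compat_r; [apply Rabs_pos|]. now apply Rabs_le. }
      eapply Rle_trans; [apply Rmult_le_compat_l; [auto|apply Hs]|].
      apply Rmult_le_compat_r; [apply sqrt_pos|]. apply Hp.
      eapply nc_in_strip; eauto. }
  destruct Hg as (_ & _ & _ & Hx & _). unfold Ak_x in Hx.
  destruct (Z_le_gt_dec 0 k) as [H0|H0].
  - rewrite Z.abs_eq by lia. specialize (HG 1). rewrite Hx in HG. lra.
  - rewrite Z.abs_neq by lia. rewrite opp_IZR. specialize (HG (-1)). rewrite Hx in HG. lra.
Qed.

(** * Comparison with the round sphere *)

Lemma is_derive_asin (x : R) : -1 < x < 1 -> is_derive asin x (/ sqrt (1 - x ^ 2)).
Proof.
  intros Hx. apply is_derive_Reals.
  pose proof (derive_pt_asin x Hx) as E.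
  apply derive_pt_eq_1 in E. unfold Rsqr in E.
  replace (/ sqrt (1 - x ^ 2)) with (1 / sqrt (1 - x * x)); auto.
  unfold Rdiv. rewrite Rmult_1_l. do 3 f_equal. ring.
Qed.

Lemma tanh_sinh (y : R) : tanh_ y = sinh y / cosh y.
Proof.
  unfold tanh_, sinh, cosh. pose proof (exp_pos y). pose proof (exp_pos (- y)).
  field. lra.
Qed.

Lemma phi0_tanh (y : R) : phi0 y ^ 2 + tanh_ y ^ 2 = 1.
Proof.
  rewrite phi0_cosh, tanh_sinh. pose proof (cosh_pos y). pose proof (cosh2_sinh2 y).
  transitivity ((1 + sinh y ^ 2) / cosh y ^ 2); [field; lra|].
  rewrite <- H0. field. lra.
Qed.

Lemma phi0_even (y : R) : phi0 (- y) = phi0 y.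
Proof. rewrite !phi0_cosh. unfold cosh. rewrite Ropp_involutive. f_equal. lra. Qed.

Lemma tanh_odd (y : R) : tanh_ (- y) = - tanh_ y.
Proof.
  rewrite !tanh_sinh. unfold sinh, cosh. rewrite Ropp_involutive.
  pose proof (exp_pos y). pose proof (exp_pos (- y)). field. lra.
Qed.

Lemma is_derive_tanh (y : R) : is_derive tanh_ y (phi0 y ^ 2).
Proof.
  unfold tanh_, phi0. pose proof (exp_pos y). pose proof (exp_pos (- y)).
  auto_derive; [lra|].
  replace (2 * y) with (y + y) by ring. rewrite exp_plus, exp_Ropp.
  field. repeat split; nra.
Qed.

Lemma is_derive_phi0 (y : R) : is_derive phi0 y (- phi0 y * tanh_ y).
Proof.
  unfold tanh_, phi0. pose proof (exp_pos y). pose proof (exp_pos (- y)).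
  pose proof (exp_pos (2 * y)).
  auto_derive; [lra|].
  replace (2 * y) with (y + y) by ring. rewrite exp_plus, exp_Ropp.
  field. repeat split; nra.
Qed.

Lemma phi0_pos (y : R) : 0 < phi0 y.
Proof. rewrite phi0_cosh. apply Rinv_0_lt_compat, cosh_pos. Qed.

Lemma cont_tanh (y : R) : continuous tanh_ y.
Proof.
  apply (ex_derive_continuous (K := R_AbsRing) (V := R_NormedModule)).
  eexists; apply is_derive_tanh.
Qed.

Lemma cauchy_schwarz2 (a b x y : R) :
  (a * x + b * y) ^ 2 <= (a ^ 2 + b ^ 2) * (x ^ 2 + y ^ 2).
Proof. pose proof (pow2_ge_0 (a * y - b * x)). nra. Qed.

Section Sphere.

Variables (x0 y0 : R).

(* [(phi0 y cos x, phi0 y sin x, tanh y)] maps [phi0 ^ 2 * g_flat] isometrically to the round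
   sphere and [A] to the antipodal map; [sphere_inner] is the inner product with
   the image of [(x0, y0)]. *)
Let sphere_inner (x y : R) : R :=
  phi0 y * phi0 y0 * cos (x - x0) + tanh_ y * tanh_ y0.
Let inner_x (x y : R) : R := - (phi0 y * phi0 y0 * sin (x - x0)).
Let inner_y (x y : R) : R :=
  phi0 y * (phi0 y * tanh_ y0 - tanh_ y * phi0 y0 * cos (x - x0)).

(** On the round sphere the gradient of <X, X0> = cos d has squared norm sin^2 d = 1 - <X, X0>^2;
    the factor [phi0 y ^ 2] converts it to the flat metric. [inner_x] and [inner_y] are the partial
    derivatives of [sphere_inner]. *)
Local Lemma sphere_gradient (x y : R) :
  inner_x x y ^ 2 + inner_y x y ^ 2 = phi0 y ^ 2 * (1 - sphere_inner x y ^ 2).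
Proof.
  unfold inner_x, inner_y, sphere_inner.
  pose proof (phi0_tanh y) as H. pose proof (phi0_tanh y0) as H0.
  pose proof (sin2_cos2 (x - x0)) as Hs. unfold Rsqr in Hs.
  set (S := phi0 y) in *. set (T := tanh_ y) in *.
  set (S0 := phi0 y0) in *. set (T0 := tanh_ y0) in *.
  set (c := cos (x - x0)) in *. set (s := sin (x - x0)) in *.
  assert (Hs2 : s ^ 2 = 1 - c ^ 2) by (simpl; lra).
  assert (HT : T ^ 2 = 1 - S ^ 2) by lra.
  assert (HT0 : T0 ^ 2 = 1 - S0 ^ 2) by lra.
  transitivity (S ^ 2 * (S0 ^ 2 * s ^ 2 + S ^ 2 * T0 ^ 2 - 2 * S * T0 * T * S0 * c
     + T ^ 2 * S0 ^ 2 * c ^ 2)); [ring|].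
  transitivity (S ^ 2 * (1 - (S ^ 2 * S0 ^ 2 * c ^ 2 + 2 * S * S0 * c * T * T0
     + T ^ 2 * T0 ^ 2))); [|ring].
  rewrite Hs2, HT, HT0. ring.
Qed.

(** The left side of [sphere_gradient] is a sum of squares and [phi0 y ^ 2] is positive. *)
Local Lemma sphere_inner_bound (x y : R) : sphere_inner x y ^ 2 <= 1.
Proof.
  pose proof (sphere_gradient x y). pose proof (phi0_pos y).
  pose proof (pow2_ge_0 (inner_x x y)). pose proof (pow2_ge_0 (inner_y x y)).
  assert (0 < phi0 y ^ 2) by nra. nra.
Qed.

(* [asin (e <X, X0>)] with [e < 1] rather than [asin <X, X0>], which is not
   differentiable at the two end points. *)
Lemma antipodal_length (beta : R) (psi : R -> R -> R) (gx gy : R -> R) (k : Z) (e : R) :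
  continuous2 psi -> (forall x y, in_strip beta x y -> phi0 y <= psi x y) ->
  nc_closed_curve beta gx gy k -> (k = 1 \/ k = -1)%Z -> gx 0 = x0 -> gy 0 = y0 ->
  0 < e < 1 -> 2 * asin e <= curve_length psi gx gy.
Proof.
  intros Hpsi Hp Hg Hk Hx0 Hy0 He.
  set (f := fun t => sphere_inner (gx t) (gy t)).
  set (df := fun t => inner_x (gx t) (gy t) * Derive gx t + inner_y (gx t) (gy t) * Derive gy t).
  assert (Hf : forall t, is_derive f t (df t)).
  { intros t. destruct (nc_derivable _ _ _ _ t Hg) as [Hdx Hdy].
    unfold f, df, sphere_inner, inner_x, inner_y.
    auto_derive.
    - repeat split; auto; eexists; [apply is_derive_phi0|apply is_derive_tanh].
    - change (Derive (fun y => phi0 y)) with (Derive phi0).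
      change (Derive (fun y => tanh_ y)) with (Derive tanh_).
      change (Derive (fun y => gx y)) with (Derive gx).
      change (Derive (fun y => gy y)) with (Derive gy).
      rewrite (is_derive_unique _ _ _ (is_derive_phi0 (gy t))),
        (is_derive_unique _ _ _ (is_derive_tanh (gy t))). unfold Rminus. ring. }
  assert (Hfb : forall t, f t ^ 2 <= 1) by (intros; apply sphere_inner_bound).
  assert (Hef : forall t, 0 < 1 - (- e * f t) ^ 2).
  { intros t. specialize (Hfb t). assert (e ^ 2 < 1) by nra.
    rewrite Rpow_mult_distr. pose proof (pow2_ge_0 (f t)). nra. }
  assert (Hf0 : f 0 = 1).
  { unfold f, sphere_inner. rewrite Hx0, Hy0, Rminus_diag, cos_0.
    transitivity (phi0 y0 ^ 2 + tanh_ y0 ^ 2); [ring|apply phi0_tanh]. }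
  (* The end point is the antipode of the starting point: the cosine changes sign, [phi0] is even
     and [tanh_] is odd. *)
  assert (Hf1 : f 1 = -1).
  { destruct Hg as (_ & _ & _ & Hgx & Hgy). unfold f, sphere_inner.
    rewrite Hgx, Hgy, Hx0, Hy0. unfold Ak_x, Ak_y.
    assert (Hc : cos (x0 + IZR k * PI - x0) = -1).
    { replace (x0 + IZR k * PI - x0) with (IZR k * PI) by ring.
      destruct Hk; subst k; [rewrite Rmult_1_l; apply cos_PI|].
      replace (IZR (-1) * PI) with (- PI) by (simpl; ring). rewrite cos_neg. apply cos_PI. }
    rewrite Hc.
    replace ((-1) ^ Z.abs_nat k * y0) with (- y0) by (destruct Hk; subst k; simpl; ring).
    rewrite phi0_even, tanh_odd.
    transitivity (- (phi0 y0 ^ 2 + tanh_ y0 ^ 2)); [ring|]. rewrite phi0_tanh. reflexivity. }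
  replace (2 * asin e) with (asin (- e * f 1) - asin (- e * f 0)).
  2:{ rewrite Hf0, Hf1. rewrite Rmult_1_r.
      replace (- e * -1) with e by ring. rewrite asin_opp. ring. }
  apply (curve_length_calibration beta psi gx gy k (fun t => asin (- e * f t))
    (fun t => (- e * df t) * / sqrt (1 - (- e * f t) ^ 2))); auto.
  - intros t _. apply (is_derive_comp asin (fun t => - e * f t)).
    + apply is_derive_asin. specialize (Hfb t). split; nra.
    + apply is_derive_scal, Hf.
  - intros t Ht. destruct (nc_derivable _ _ _ _ t Hg) as [Hdx Hdy].
    destruct (nc_C1 _ _ _ _ t Hg Ht) as [Hcx Hcy].
    assert (Hgx : continuous gx t)
      by (apply (ex_derive_continuous (K := R_AbsRing) (V := R_NormedModule)); auto).
    assert (Hgy : continuous gy t)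
      by (apply (ex_derive_continuous (K := R_AbsRing) (V := R_NormedModule)); auto).
    assert (Hft : continuous f t).
    { apply (ex_derive_continuous (K := R_AbsRing) (V := R_NormedModule)). eexists; apply Hf. }
    assert (Hs : continuous (fun t => phi0 (gy t)) t) by (apply cont_comp; auto using cont_phi0).
    assert (HT : continuous (fun t => tanh_ (gy t)) t) by (apply cont_comp; auto using cont_tanh).
    unfold df, inner_x, inner_y. cont; auto.
    apply Rgt_not_eq, sqrt_lt_R0, Hef.
  - intros t Ht.
    assert (Hst : in_strip beta (gx t) (gy t)) by (eapply nc_in_strip; eauto).
    apply Rle_trans with (phi0 (gy t) * sqrt (Derive gx t ^ 2 + Derive gy t ^ 2)).
    2:{ apply Rmult_le_compat_r; [apply sqrt_pos|auto]. }
    change ((- e * df t) / sqrt (1 - (- e * f t) ^ 2) <=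
      phi0 (gy t) * sqrt (Derive gx t ^ 2 + Derive gy t ^ 2)).
    apply Rle_div_l; [apply sqrt_lt_R0, Hef|].
    pose proof (phi0_pos (gy t)) as Hp0.
    set (n := Derive gx t ^ 2 + Derive gy t ^ 2).
    assert (Hn : 0 <= n).
    { unfold n. pose proof (pow2_ge_0 (Derive gx t)).
      pose proof (pow2_ge_0 (Derive gy t)). lra. }
    apply Rsqr_incr_0_var.
    2:{ apply Rmult_le_pos; [apply Rmult_le_pos; [lra|apply sqrt_pos]|apply sqrt_pos]. }
    rewrite !Rsqr_mult, !Rsqr_sqrt by (auto; apply Rlt_le, Hef).
    rewrite <- !Rsqr_pow2.
    (* Cauchy-Schwarz for the gradient and the velocity. *)
    assert (Hcs : Rsqr (df t) <= phi0 (gy t) ^ 2 * (1 - f t ^ 2) * n).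
    { rewrite Rsqr_pow2. unfold f. rewrite <- sphere_gradient. apply cauchy_schwarz2. }
    unfold Rsqr at 1 3 4. specialize (Hfb t).
    apply Rle_trans with (e * e * (phi0 (gy t) ^ 2 * (1 - f t ^ 2) * n)).
    { replace (- e * - e) with (e * e) by ring. apply Rmult_le_compat_l; nra. }
    (* What remains is e^2 (1 - f^2) <= 1 - e^2 f^2, that is e^2 <= 1. *)
    replace (- e * f t * (- e * f t)) with (e * e * f t ^ 2) by ring.
    replace (e * e * (phi0 (gy t) ^ 2 * (1 - f t ^ 2) * n)) with
      (phi0 (gy t) * phi0 (gy t) * n * (e * e * (1 - f t ^ 2))) by ring.
    apply Rmult_le_compat_l; nra.
Qed.

End Sphere.

(** For |k| >= 2 the bound 1/2 on the factor and the flat width 2 PI give PI; for |k| = 1 the factor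
    [phi0] makes the curve at least as long as a path between antipodal points of the unit
    sphere. *)
Lemma length_ge_PI (beta : R) (psi : R -> R -> R) (gx gy : R -> R) (k : Z) :
  continuous2 psi -> (forall x y, in_strip beta x y -> phi_beta x y <= psi x y) ->
  nc_closed_curve beta gx gy k -> PI <= curve_length psi gx gy.
Proof.
  intros Hpsi Hp Hg. pose proof PI_RGT_0.
  assert (Hk0 : k <> 0%Z) by exact (proj1 Hg).
  destruct (Z_le_gt_dec 2 (Z.abs k)) as [H2|H1].
  - apply Rle_trans with (1 / 2 * (IZR (Z.abs k) * PI)).
    + apply IZR_le in H2. nra.
    + apply (curve_length_winding beta (1 / 2) psi gx gy k); auto; [lra|].
      intros x y Hxy. eapply Rle_trans; [apply Rmax_r|apply (Hp x y Hxy)].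
  - set (L := curve_length psi gx gy).
    apply Rnot_lt_le. intros Hlt.
    assert (HL0 : 0 <= L).
    { eapply curve_length_nonneg; eauto. intros x y Hxy.
      eapply Rle_trans; [|apply (Hp x y Hxy)].
      eapply Rle_trans; [|apply Rmax_r]. lra. }
    (* The midpoint of L / 2 and PI / 2: with e = sin th the bound reads 2 th <= L, which
       contradicts L < PI. *)
    set (th := (L + PI) / 4).
    assert (Hth : 2 * asin (sin th) <= L).
    { apply (antipodal_length (gx 0) (gy 0) beta psi gx gy k); auto.
      - intros x y Hxy. eapply Rle_trans; [apply Rmax_l|apply (Hp x y Hxy)].
      - lia.
      - split.
        + apply sin_gt_0; unfold th; lra.
        + rewrite <- sin_PI2. apply sin_increasing_1; unfold th; lra. }
    rewrite asin_sin in Hth by (unfold th; lra). unfold th in Hth. lra.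
Qed.

(** * The systole of [phi_beta] and the height [beta1] *)

Lemma cont2_phi_beta : continuous2 phi_beta.
Proof.
  intros x y. unfold phi_beta. cont.
  apply (cont_comp phi0); [apply cont_phi0|cont].
Qed.

Lemma equator_nc (beta : R) : 0 < beta -> nc_closed_curve beta (fun t => PI * t) (fun _ => 0) 1.
Proof.
  intros Hb. split; [lia|]. split; [|split; [|split]].
  - intros t; split; auto_derive; auto.
  - intros t _. split; [|split].
    + apply (continuous_ext (fun _ => PI)); [|apply continuous_const].
      intros s. symmetry. apply is_derive_unique. auto_derive; auto. ring.
    + apply (continuous_ext (fun _ => 0)); [|apply continuous_const].
      intros s. symmetry. apply Derive_const.
    + unfold in_strip; lra.
  - unfold Ak_x. ring.
  - unfold Ak_y. ring.
Qed.

Lemma sys_le_length (beta : R) (psi : R -> R -> R) (gx gy : R -> R) (k : Z) :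
  continuous2 psi -> (forall x y, in_strip beta x y -> 0 <= psi x y) ->
  nc_closed_curve beta gx gy k -> sys beta psi <= curve_length psi gx gy.
Proof.
  intros Hpsi Hp Hg. unfold sys. eapply real_Glb_Rbar; [| |exists gx, gy, k; eauto].
  - intros L (gx' & gy' & k' & Hg' & ->). eapply curve_length_nonneg; eauto.
  - exists gx, gy, k; eauto.
Qed.

Lemma sys_ge (beta m : R) (psi : R -> R -> R) :
  0 < beta ->
  (forall gx gy k, nc_closed_curve beta gx gy k -> m <= curve_length psi gx gy) ->
  m <= sys beta psi.
Proof.
  intros Hb Hm. unfold sys.
  apply (real_Glb_Rbar _ m (curve_length psi (fun t => PI * t) (fun _ => 0))).
  - intros L (gx & gy & k & Hg & ->). eauto.
  - do 3 eexists. split; [apply equator_nc, Hb|reflexivity].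
Qed.

Lemma phi_beta_ge_half (x y : R) : 1 / 2 <= phi_beta x y.
Proof. apply Rmax_r. Qed.

Lemma phi_beta_le_1 (x y : R) : phi_beta x y <= 1.
Proof.
  apply Rmax_lub; [|lra].
  pose proof (phi0_tanh y). pose proof (pow2_ge_0 (tanh_ y)). pose proof (phi0_pos y). nra.
Qed.

(** The equator has length c PI because the factor is c there; [length_ge_PI] applied to psi / c
    gives the converse. *)
Lemma sys_scal_phi_beta (beta c : R) (psi : R -> R -> R) :
  0 < beta -> 0 < c -> continuous2 psi ->
  (forall x y, in_strip beta x y -> psi x y = c * phi_beta x y) ->
  sys beta psi = c * PI.
Proof.
  intros Hb Hc Hpsi Hp. apply Rle_antisym.
  - eapply Rle_trans; [apply (sys_le_length beta psi _ _ _ Hpsi) with (2 := equator_nc beta Hb)|].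
    + intros x y Hxy. rewrite Hp by auto. pose proof (phi_beta_ge_half x y). nra.
    + apply Req_le. unfold curve_length.
      rewrite (RInt_ext _ (fun _ => c * PI)); [rewrite RInt_cst; ring|].
      intros t _. rewrite Hp by (unfold in_strip; lra).
      rewrite Derive_const.
      replace (Derive (fun t => PI * t) t) with PI.
      2:{ symmetry. apply is_derive_unique. auto_derive; auto. ring. }
      replace (PI ^ 2 + 0 ^ 2) with (PI ^ 2) by ring.
      rewrite sqrt_pow2 by (apply Rlt_le, PI_RGT_0).
      replace (phi_beta (PI * t) 0) with 1; [as_R; ring|].
      unfold phi_beta, phi0. rewrite Rmult_0_r, exp_0.
      rewrite Rmax_left by lra. field.
  - apply sys_ge; auto. intros gx gy k Hg.
    apply Rmult_le_reg_l with (/ c); [now apply Rinv_0_lt_compat|].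
    rewrite <- Rmult_assoc, Rinv_l, Rmult_1_l by lra.
    replace (/ c * curve_length psi gx gy) with
      (curve_length (fun x y => / c * psi x y) gx gy).
    + apply (length_ge_PI beta _ gx gy k); auto.
      * intros x y. cont.
      * intros x y Hxy. rewrite Hp by auto. apply Req_le. field. lra.
    (* [RInt_mulc] asks for continuity on the whole line, whereas the velocity is known to be
       continuous on [0, 1] only. *)
    + unfold curve_length. apply is_RInt_unique.
      apply (is_RInt_ext (fun t => scal (/ c) (psi (gx t) (gy t) *
         sqrt (Derive gx t ^ 2 + Derive gy t ^ 2)))).
      * intros t _. unfold scal; simpl; unfold mult; simpl. ring.
      * apply (is_RInt_scal (V := R_NormedModule)), (RInt_correct (V := R_CompleteNormedModule)).
        eapply ex_RInt_length; eauto.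
Qed.

Lemma sinh_beta1 : sinh beta1 = sqrt 3.
Proof.
  assert (H3 : sqrt 3 * sqrt 3 = 3) by (apply sqrt_sqrt; lra).
  pose proof (sqrt_pos 3).
  unfold sinh, beta1. rewrite exp_Ropp, exp_ln by lra.
  replace (/ (2 + sqrt 3)) with (2 - sqrt 3); [field|].
  apply (Rmult_eq_reg_r (2 + sqrt 3)); [|lra]. rewrite Rinv_l by lra. nra.
Qed.

Lemma cosh_beta1 : cosh beta1 = 2.
Proof.
  rewrite <- sqrt_cosh, sinh_beta1. rewrite pow2_sqrt by lra.
  replace (1 + 3) with (2 ^ 2) by ring. apply sqrt_pow2. lra.
Qed.

Lemma beta1_pos : 0 < beta1.
Proof.
  unfold beta1. rewrite <- ln_1. apply ln_increasing; [lra|].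
  pose proof (sqrt_pos 3). lra.
Qed.

Lemma sinh_le (x y : R) : x <= y -> sinh x <= sinh y.
Proof. intros [H|H]; [apply Rlt_le, sinh_lt, H|subst; apply Rle_refl]. Qed.

Lemma cosh_le (x y : R) : 0 <= x <= y -> cosh x <= cosh y.
Proof.
  intros H. rewrite <- !sqrt_cosh. apply sqrt_le_1_alt.
  assert (0 <= sinh x) by (rewrite <- sinh_0; apply sinh_le; lra).
  assert (sinh x <= sinh y) by (apply sinh_le; lra). nra.
Qed.

Lemma phi_beta_inner (x y : R) : 0 <= y <= beta1 -> phi_beta x y = phi0 y.
Proof.
  intros H. unfold phi_beta. apply Rmax_left. rewrite phi0_cosh.
  pose proof (cosh_le y beta1 H). rewrite cosh_beta1 in H0. pose proof (cosh_pos y).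
  unfold Rdiv. rewrite Rmult_1_l. apply Rinv_le_contravar; lra.
Qed.

Lemma phi_beta_outer (x y : R) : beta1 <= y -> phi_beta x y = 1 / 2.
Proof.
  intros H. unfold phi_beta. apply Rmax_right. rewrite phi0_cosh.
  pose proof beta1_pos.
  assert (H1 : cosh beta1 <= cosh y) by (apply cosh_le; lra).
  rewrite cosh_beta1 in H1.
  unfold Rdiv. rewrite Rmult_1_l. apply Rinv_le_contravar; lra.
Qed.

Lemma phi_beta_even (x x' y : R) : phi_beta x' (- y) = phi_beta x y.
Proof. unfold phi_beta. now rewrite phi0_even. Qed.

(** * The projection inequality *)

(** Invariant factors on the whole plane, so that continuity and positivity carry no restriction to
    the strip; [conformal_factor_extension] provides them. *)
Definition strip_metric (f : R -> R -> R) : Prop :=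
  continuous2 f /\ (forall x y, 0 < f x y) /\ (forall x y, f (x + PI) (- y) = f x y).

Lemma RInt_shift (g : R -> R) (a b c : R) :
  (forall x, continuous g x) ->
  RInt (fun x => g (x + c)) a b = RInt g (a + c) (b + c).
Proof.
  intros Hg. rewrite <- (RInt_subst g (fun x => x + c) (fun _ => 1)); auto.
  - apply RInt_ext. intros. as_R. ring.
  - intros x. auto_derive; auto; ring.
  - intros; cont.
Qed.

Lemma RInt_reflect (g : R -> R) (b : R) :
  (forall x, continuous g x) ->
  RInt g (- b) b = RInt (fun x => g x + g (- x)) 0 b.
Proof.
  intros Hg. rewrite RInt_add by (auto; intros; cont).
  rewrite (RInt_split g (- b) 0 b) by auto.
  assert (E : RInt (fun x => g (- x)) 0 b = RInt g (- b) 0).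
  { pose proof (RInt_subst g Ropp (fun _ => -1) 0 b Hg) as E.
    rewrite Ropp_0 in E.
    pose proof (opp_RInt_swap g 0 (- b) (ex_RInt_cont g 0 (- b) Hg)) as E2.
    change (- RInt g 0 (- b) = RInt g (- b) 0) in E2.
    rewrite <- E2, <- E.
    - rewrite (RInt_mulc (fun x => g (- x))) by (intros; cont). symmetry. as_R. ring.
    - intros x. auto_derive; auto; ring.
    - intros; cont. }
  rewrite E. as_R. ring.
Qed.

Lemma RInt_periodic (g : R -> R) (a P : R) :
  (forall x, continuous g x) -> (forall x, g (x + P) = g x) ->
  RInt g a (a + P) = RInt g 0 P.
Proof.
  intros Hg HP.
  pose proof (RInt_shift g 0 a P Hg) as E.
  rewrite (RInt_ext (fun x => g (x + P)) g) in E by (intros; apply HP).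
  rewrite Rplus_0_l in E.
  rewrite (RInt_split g a 0 (a + P)), (RInt_split g 0 P (a + P)) by auto.
  rewrite <- E. pose proof (RInt_split g 0 a 0 Hg) as E0.
  rewrite RInt_point in E0. change (@zero R_CompleteNormedModule) with 0 in E0. lra.
Qed.

(** The great semicircle sinh y = c sin (x - x0), run through with x at constant speed PI. *)
Definition great_circle_x (x0 t : R) : R := x0 + PI * t.
Definition great_circle_y (c t : R) : R := arcsinh (c * sin (PI * t)).

Lemma great_circle_x_derive (x0 t : R) : is_derive (great_circle_x x0) t PI.
Proof. unfold great_circle_x. auto_derive; auto. ring. Qed.

Lemma great_circle_y_derive (c t : R) :
  is_derive (great_circle_y c) t
    (PI * c * cos (PI * t) / sqrt (1 + (c * sin (PI * t)) ^ 2)).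
Proof.
  unfold great_circle_y. evar_last.
  - apply (is_derive_comp arcsinh (fun t => c * sin (PI * t))).
    + apply is_derive_arcsinh.
    + auto_derive; auto.
  - unfold scal; simpl; unfold mult; simpl.
    replace (c * sin (PI * t) * (c * sin (PI * t) * 1)) with ((c * sin (PI * t)) ^ 2) by ring.
    field. apply sqrt_one_plus_sqr_neq0.
Qed.

Lemma great_circle_nc (beta x0 c : R) : 0 < beta -> 0 <= c <= sinh beta ->
  nc_closed_curve beta (great_circle_x x0) (great_circle_y c) 1.
Proof.
  intros Hb Hc. split; [lia|]. split; [|split; [|split]].
  - intros t. split; eexists; [apply great_circle_x_derive|apply great_circle_y_derive].
  - intros t Ht. split; [|split].
    + apply (continuous_ext (fun _ => PI)); [|apply continuous_const].
      intros s. symmetry. apply is_derive_unique, great_circle_x_derive.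
    + apply (continuous_ext
        (fun t => PI * c * cos (PI * t) / sqrt (1 + (c * sin (PI * t)) ^ 2))).
      * intros s. symmetry. apply is_derive_unique, great_circle_y_derive.
      * cont. apply sqrt_one_plus_sqr_neq0.
    + pose proof PI_RGT_0.
      assert (0 <= sin (PI * t) <= 1) by (split; [apply sin_ge_0; nra|apply SIN_bound]).
      unfold in_strip, great_circle_y. split.
      * apply Rle_trans with 0; [lra|]. rewrite <- arcsinh_0. apply arcsinh_le. nra.
      * rewrite <- (arcsinh_sinh beta). apply arcsinh_le. nra.
  - unfold Ak_x, great_circle_x. ring.
  - unfold Ak_y, great_circle_y. simpl.
    rewrite Rmult_0_r, Rmult_1_r, sin_0, sin_PI, Rmult_0_r, arcsinh_0. ring.
Qed.

(** With y as a function of x, 1 + y'^2 = (1 + c^2) / (1 + c^2 sin^2 (x - x0)). *)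
Lemma great_circle_length (x0 c : R) (f : R -> R -> R) :
  curve_length f (great_circle_x x0) (great_circle_y c) =
  RInt (fun t => f (x0 + PI * t) (arcsinh (c * sin (PI * t))) *
          (PI * (sqrt (1 + c ^ 2) / sqrt (1 + (c * sin (PI * t)) ^ 2)))) 0 1.
Proof.
  unfold curve_length. apply RInt_ext. intros t _.
  rewrite (is_derive_unique _ _ _ (great_circle_x_derive x0 t)),
    (is_derive_unique _ _ _ (great_circle_y_derive c t)).
  unfold great_circle_x, great_circle_y. f_equal.
  pose proof (sqrt_one_plus_sqr_neq0 (c * sin (PI * t))) as Hq.
  assert (Hq2 : sqrt (1 + (c * sin (PI * t)) ^ 2) ^ 2 = 1 + (c * sin (PI * t)) ^ 2)
    by (apply pow2_sqrt, Rlt_le, one_plus_sqr_pos).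
  assert (Hq0 : 0 < sqrt (1 + (c * sin (PI * t)) ^ 2))
    by (apply sqrt_lt_R0, one_plus_sqr_pos).
  set (q := sqrt (1 + (c * sin (PI * t)) ^ 2)) in *.
  assert (Hc2 : sqrt (1 + c ^ 2) ^ 2 = 1 + c ^ 2)
    by (apply pow2_sqrt, Rlt_le, one_plus_sqr_pos).
  apply sqrt_lem_1.
  - apply Rplus_le_le_0_compat; apply pow2_ge_0.
  - apply Rmult_le_pos; [apply Rlt_le, PI_RGT_0|].
    apply Rdiv_le_0_compat; [apply sqrt_pos|auto].
  - transitivity (PI ^ 2 * (sqrt (1 + c ^ 2) ^ 2 / q ^ 2)); [field; auto|].
    transitivity (PI ^ 2 * ((q ^ 2 + c ^ 2 * cos (PI * t) ^ 2) / q ^ 2)); [|field; auto].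
    do 2 f_equal. rewrite Hc2, Hq2.
    pose proof (sin2_cos2 (PI * t)) as Hs. rewrite !Rsqr_pow2 in Hs.
    rewrite Rpow_mult_distr.
    replace (cos (PI * t) ^ 2) with (1 - sin (PI * t) ^ 2) by lra. ring.
Qed.

Section Projection.

Variables (beta : R) (f : R -> R -> R).
Hypotheses (Hbeta : 0 < beta) (Hf : strip_metric f).

(** The period is 2 PI because A^2, and not A, preserves each height; up to the factor 2 PI this is
    the average of [f] over rotations. *)
Let Psi (y : R) : R := RInt (fun x => f x y) 0 (2 * PI).

Local Lemma f_cont : continuous2 f.
Proof. apply Hf. Qed.
Local Lemma f_nonneg (x y : R) : in_strip beta x y -> 0 <= f x y.
Proof. intros _. apply Rlt_le, Hf. Qed.
Local Lemma f_period (x y : R) : f (x + 2 * PI) y = f x y.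
Proof.
  destruct Hf as (_ & _ & H). rewrite <- (H x y), <- (H (x + PI) (- y)).
  f_equal; ring.
Qed.

Local Lemma Psi_cont (y : R) : continuous Psi y.
Proof.
  unfold Psi. apply (continuous_RInt_param (fun y x => f x y)), continuous2_swap, f_cont.
Qed.

(** The length bound for the circle starting at x0 is integrated over x0 in [0, 2 PI]. *)
Local Lemma sys_le_great_circles (c : R) : 0 <= c <= sinh beta ->
  2 * PI * sys beta f <= sqrt (1 + c ^ 2) *
    RInt (fun u => Psi (arcsinh (c * sin u)) / sqrt (1 + (c * sin u) ^ 2)) 0 PI.
Proof.
  intros Hc. pose proof PI_RGT_0 as Hpi. pose proof f_cont as Hfc.
  set (w := fun t => PI * (sqrt (1 + c ^ 2) / sqrt (1 + (c * sin (PI * t)) ^ 2))).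
  assert (Hw : forall t, continuous w t).
  { intros t. unfold w. cont. apply sqrt_one_plus_sqr_neq0. }
  set (F := fun x t => f (x + PI * t) (arcsinh (c * sin (PI * t))) * w t).
  assert (HF : continuous2 F) by (intros x t; unfold F; cont).
  assert (E1 : 2 * PI * sys beta f <= RInt (fun x => RInt (fun t => F x t) 0 1) 0 (2 * PI)).
  { replace (2 * PI * sys beta f) with (RInt (fun _ => sys beta f) 0 (2 * PI))
      by (rewrite RInt_cst; as_R; ring).
    apply RInt_mono; [intros; cont|now apply continuous_RInt_param|lra|].
    intros x _. unfold F, w. rewrite <- (great_circle_length x c f).
    apply (sys_le_length beta f _ _ 1); auto using f_nonneg.
    now apply great_circle_nc. }
  (* At fixed t the x-integral covers a full period, so the shift by PI t disappears and [Psi]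
     remains; then u = PI t. *)
  rewrite Fubini_continuous in E1 by (auto; lra).
  eapply Rle_trans; [apply E1|]. apply Req_le.
  rewrite <- RInt_mulc.
  2:{ intros u. cont; auto using Psi_cont, sqrt_one_plus_sqr_neq0. apply (cont_comp Psi).
      - apply Psi_cont.
      - cont. }
  match goal with |- _ = RInt ?I 0 PI => transitivity (RInt I (PI * 0) (PI * 1)) end;
    [|now rewrite Rmult_0_r, Rmult_1_r].
  rewrite <- (RInt_subst _ (fun t => PI * t) (fun _ => PI)).
  - apply RInt_ext. intros t _. unfold F.
    rewrite (RInt_ext _ (fun x => w t * f (x + PI * t) (arcsinh (c * sin (PI * t)))))
      by (intros; as_R; ring).
    rewrite RInt_mulc by (intros; cont).
    rewrite (RInt_shift (fun x => f x (arcsinh (c * sin (PI * t)))) 0 (2 * PI) (PI * t))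
      by (intros; cont).
    replace (0 + PI * t) with (PI * t) by ring.
    replace (2 * PI + PI * t) with (PI * t + 2 * PI) by ring.
    rewrite (RInt_periodic (fun x => f x (arcsinh (c * sin (PI * t))))).
    + fold (Psi (arcsinh (c * sin (PI * t)))). unfold w. as_R. field.
      apply sqrt_one_plus_sqr_neq0.
    + intros; cont.
    + intros; apply f_period.
  - intros u. cont; auto using sqrt_one_plus_sqr_neq0.
    apply (cont_comp Psi); [apply Psi_cont|cont].
  - intros t. auto_derive; auto. ring.
  - intros; cont.
Qed.

(** A parallel run through once over 2 PI closes up under A^2 and has length [Psi y]. *)
Local Lemma sys_le_parallel (y : R) : 0 <= y <= beta -> sys beta f <= Psi y.
Proof.
  intros Hy. pose proof PI_RGT_0. pose proof f_cont as Hfc.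
  assert (Hd : forall t, is_derive (fun t => 2 * PI * t) t (2 * PI))
    by (intros; auto_derive; auto; ring).
  assert (Hg : nc_closed_curve beta (fun t => 2 * PI * t) (fun _ => y) 2).
  { split; [lia|]. split; [|split; [|split]].
    - intros t; split; auto_derive; auto.
    - intros t _. split; [|split].
      + apply (continuous_ext (fun _ => 2 * PI)); [|apply continuous_const].
        intros s. symmetry. apply is_derive_unique, Hd.
      + apply (continuous_ext (fun _ => 0)); [|apply continuous_const].
        intros s. symmetry. apply Derive_const.
      + unfold in_strip; lra.
    - unfold Ak_x. ring.
    - unfold Ak_y. simpl. ring. }
  eapply Rle_trans; [apply (sys_le_length _ _ _ _ _ Hfc f_nonneg Hg)|]. apply Req_le.
  unfold curve_length, Psi.
  transitivity (RInt (fun x => f x y) (2 * PI * 0) (2 * PI * 1));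
    [|now rewrite Rmult_0_r, Rmult_1_r].
  rewrite <- (RInt_subst (fun x => f x y) (fun t => 2 * PI * t) (fun _ => 2 * PI)); auto.
  - apply RInt_ext. intros t _. rewrite Derive_const.
    replace (Derive (fun t => 2 * PI * t) t) with (2 * PI)
      by (symmetry; apply is_derive_unique, Hd).
    replace ((2 * PI) ^ 2 + 0 ^ 2) with ((2 * PI) ^ 2) by ring.
    rewrite sqrt_pow2 by lra. as_R. ring.
  - intros; cont.
  - intros; cont.
Qed.

(** A moves the lower half of the fundamental domain to the upper half strip over [PI, 2 PI]. *)
Local Lemma L2_inner_Psi : L2_inner beta f phi_beta = RInt (fun y => Psi y * phi_beta 0 y) 0 beta.
Proof.
  pose proof PI_RGT_0 as Hpi. pose proof f_cont as Hfc. pose proof cont2_phi_beta as Hpc.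
  unfold L2_inner.
  rewrite (Fubini_continuous (fun x y => f x y * phi_beta x y)) by (auto; intros x y; cont).
  rewrite RInt_reflect.
  2:{ apply (continuous_RInt_param (fun y x => f x y * phi_beta x y)).
      apply (continuous2_swap (fun x y => f x y * phi_beta x y)). intros x y; cont. }
  apply RInt_ext. intros y _.
  rewrite (RInt_ext (fun x => f x y * phi_beta x y) (fun x => phi_beta 0 y * f x y))
    by (intros; unfold phi_beta; as_R; ring).
  rewrite (RInt_ext (fun x => f x (- y) * phi_beta x (- y))
             (fun x => phi_beta 0 y * f (x + PI) y)).
  2:{ intros x _. rewrite (phi_beta_even 0). destruct Hf as (_ & _ & H).
      rewrite <- (H x (- y)), Ropp_involutive. as_R. ring. }
  rewrite !RInt_mulc by (intros; cont).
  rewrite (RInt_shift (fun x => f x y)) by (intros; cont).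
  unfold Psi. rewrite (RInt_split (fun x => f x y) 0 PI (2 * PI)) by (intros; cont).
  replace (0 + PI) with PI by ring. replace (PI + PI) with (2 * PI) by ring.
  as_R. ring.
Qed.

(** Great circles are used up to height [Rmin beta beta1], parallels with weight 1/2 above. The
    bracket is the squared norm of [phi_beta] divided by PI, so equality holds for [phi_beta]
    itself. *)
Lemma projection_inequality :
  sys beta f * (2 * tanh_ (Rmin beta beta1) + (beta - Rmin beta beta1) / 2)
    <= L2_inner beta f phi_beta.
Proof.
  set (b := Rmin beta beta1).
  assert (Hb : 0 < b) by (apply Rmin_pos; [auto|apply beta1_pos]).
  pose proof (Rmin_l beta beta1) as Hb1.
  pose proof (Rmin_r beta beta1) as Hb2. fold b in Hb1, Hb2.
  pose proof cont2_phi_beta as Hpc.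
  assert (Hc : forall y, continuous (fun y => Psi y * phi_beta 0 y) y).
  { intros y. apply cont_mult; [apply Psi_cont|now apply continuous2_r]. }
  rewrite L2_inner_Psi, (RInt_split _ 0 b beta) by exact Hc.
  assert (H1 : 2 * sys beta f * (sinh b / cosh b) <= RInt (fun y => Psi y * phi_beta 0 y) 0 b).
  { rewrite (RInt_ext _ (fun y => Psi y * phi0 y)).
    - apply great_circles_average; auto using Psi_cont.
      intros c Hc'. apply sys_le_great_circles.
      pose proof (sinh_le b beta Hb1). lra.
    - intros y Hy. rewrite Rmin_left, Rmax_right in Hy by lra.
      rewrite phi_beta_inner by lra. reflexivity. }
  assert (H2 : sys beta f * ((beta - b) / 2) <= RInt (fun y => Psi y * phi_beta 0 y) b beta).
  { replace (sys beta f * ((beta - b) / 2)) with (RInt (fun _ => sys beta f / 2) b beta)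
      by (rewrite RInt_cst; as_R; field).
    destruct (Rle_lt_dec beta beta1) as [H|H].
    - replace b with beta by (unfold b; rewrite Rmin_left; auto).
      rewrite !RInt_point. apply Rle_refl.
    - apply RInt_mono; [intros; cont|exact Hc|lra|].
      intros y Hy. assert (b = beta1) by (unfold b; apply Rmin_right; lra).
      rewrite phi_beta_outer by lra. pose proof (sys_le_parallel y). lra. }
  rewrite tanh_sinh. lra.
Qed.

End Projection.

(** * Reduction to the fundamental domain and L2 geometry *)

Lemma half_period_shift (n : nat) : exists s, (s = 1 \/ s = -1) /\
  forall g x y, (forall x y, g (x + PI) (- y) = g x y :> R) ->
    g (x + INR n * PI) (s * y) = g x y.
Proof.
  induction n as [|n (s & Hs & IH)].
  - exists 1. split; auto. intros. f_equal; simpl; ring.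
  - exists (- s). split; [destruct Hs; subst; [right|left]; ring|].
    intros g x y Hg. rewrite <- (IH g x y Hg), S_INR.
    rewrite <- (Hg (x + INR n * PI) (s * y)). f_equal; ring.
Qed.

(** The representative is chosen before [g], so that one point serves for several invariant
    functions at once. *)
Lemma fundamental_domain (beta x y : R) : in_strip beta x y ->
  exists x' y', 0 <= x' <= PI /\ in_strip beta x' y' /\
    forall g, (forall x y, g (x + PI) (- y) = g x y :> R) -> g x y = g x' y'.
Proof.
  intros Hy. pose proof PI_RGT_0 as Hpi.
  assert (Hstrip : forall s, s = 1 \/ s = -1 -> forall x', in_strip beta x' (s * y)).
  { unfold in_strip in *. intros s [-> | ->] x'; lra. }
  pose proof (base_Int_part (x / PI)) as [H1 H2].
  set (k := Int_part (x / PI)) in *.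
  assert (Hx : x / PI * PI = x) by (field; lra).
  assert (Hk1 : IZR k * PI <= x) by (rewrite <- Hx; apply Rmult_le_compat_r; lra).
  assert (Hk2 : x <= IZR k * PI + PI).
  { rewrite <- Hx. replace (IZR k * PI + PI) with ((IZR k + 1) * PI) by ring.
    apply Rmult_le_compat_r; lra. }
  destruct (half_period_shift (Z.abs_nat k)) as (s & Hs & H).
  rewrite INR_IZR_INZ, Zabs2Nat.id_abs in H.
  exists (x - IZR k * PI), (s * y). split; [lra|]. split; [now apply Hstrip|].
  (* [half_period_shift] only moves to the right: it is applied from the representative if k >= 0
     and from the given point otherwise. *)
  intros g Hg. destruct (Z_le_gt_dec 0 k) as [H0|H0].
  - rewrite Z.abs_eq in H by lia. rewrite <- (H g (x - IZR k * PI) (s * y) Hg).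
    f_equal; [ring|]. destruct Hs; subst s; ring.
  - rewrite Z.abs_neq, opp_IZR in H by lia. rewrite <- (H g x y Hg).
    f_equal; ring.
Qed.

Lemma sys_ext (beta : R) (f g : R -> R -> R) :
  (forall x y, in_strip beta x y -> f x y = g x y) -> sys beta f = sys beta g.
Proof.
  intros H.
  assert (E : forall gx gy k, nc_closed_curve beta gx gy k ->
     curve_length f gx gy = curve_length g gx gy).
  { intros gx gy k Hg. apply RInt_ext. intros t Ht.
    rewrite Rmin_left, Rmax_right in Ht by lra. rewrite H; auto.
    eapply nc_in_strip; [eauto|lra]. }
  unfold sys. f_equal. apply Glb_Rbar_eqset. intros L.
  split; intros (gx & gy & k & Hg & ->); exists gx, gy, k; split; auto.
  - now apply (E _ _ k).
  - symmetry; now apply (E _ _ k).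
Qed.

Lemma L2_inner_ext (beta : R) (f g f' g' : R -> R -> R) : 0 < beta ->
  (forall x y, in_strip beta x y -> f x y = f' x y) ->
  (forall x y, in_strip beta x y -> g x y = g' x y) ->
  L2_inner beta f g = L2_inner beta f' g'.
Proof.
  intros Hb Hf Hg. apply RInt_ext. intros x _. apply RInt_ext. intros y Hy.
  rewrite Rmin_left, Rmax_right in Hy by lra.
  rewrite Hf, Hg by (unfold in_strip; lra). reflexivity.
Qed.

Lemma alpha_sys_ext (beta : R) (f g : R -> R -> R) : 0 < beta ->
  (forall x y, in_strip beta x y -> f x y = g x y) -> alpha_sys beta f = alpha_sys beta g.
Proof.
  intros Hb H. unfold alpha_sys, area.
  now rewrite (sys_ext beta f g H), (L2_inner_ext beta f f g g Hb H H).
Qed.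

Lemma L2_inner_sub_scal (beta c : R) (f g : R -> R -> R) :
  continuous2 f -> continuous2 g ->
  L2_inner beta (fun x y => f x y - c * g x y) (fun x y => f x y - c * g x y) =
  L2_inner beta f f - 2 * c * L2_inner beta f g + c ^ 2 * L2_inner beta g g.
Proof.
  intros Hf Hg. unfold L2_inner.
  assert (Hc : forall u v, continuous2 u -> continuous2 v ->
     forall x, continuous (fun x => RInt (fun y => u x y * v x y) (- beta) beta) x).
  { intros u v Hu Hv. apply (continuous_RInt_param (fun x y => u x y * v x y)).
    intros x y; cont. }
  rewrite <- !RInt_mulc, <- RInt_sub, <- RInt_add; try (intros; cont; now apply Hc).
  - apply RInt_ext. intros x _.
    rewrite <- !RInt_mulc, <- RInt_sub, <- RInt_add by (intros; cont).
    apply RInt_ext. intros y _. as_R. ring.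
Qed.

Lemma L2_inner_self_nonneg (beta : R) (f : R -> R -> R) :
  0 < beta -> continuous2 f -> 0 <= L2_inner beta f f.
Proof.
  intros Hb Hf. apply RInt_ge_0; [apply Rlt_le, PI_RGT_0| |].
  - apply ex_RInt_cont, (continuous_RInt_param (fun x y => f x y * f x y)). intros x y; cont.
  - intros x _. apply RInt_ge_0; [lra|apply ex_RInt_cont; intros; cont|].
    intros y _. apply Rle_0_sqr.
Qed.

Lemma L2_inner_self_eq0 (beta : R) (f : R -> R -> R) :
  0 < beta -> continuous2 f -> L2_inner beta f f <= 0 ->
  forall x y, 0 <= x <= PI -> in_strip beta x y -> f x y = 0.
Proof.
  intros Hb Hf H x y Hx Hy.
  assert (Hi : forall x, 0 <= RInt (fun y => f x y * f x y) (- beta) beta).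
  { intros u. apply RInt_ge_0; [lra|apply ex_RInt_cont; intros; cont|].
    intros v _. apply Rle_0_sqr. }
  assert (H0 : RInt (fun y => f x y * f x y) (- beta) beta = 0).
  { apply (RInt_cont_eq0 (fun x => RInt (fun y => f x y * f x y) (- beta) beta) 0 PI); auto.
    - apply PI_RGT_0.
    - apply (continuous_RInt_param (fun x y => f x y * f x y)). intros u v; cont. }
  apply Rsqr_0_uniq.
  apply (RInt_cont_eq0 (fun y => f x y * f x y) (- beta) beta); auto; try lra.
  - intros; cont.
  - intros; apply Rle_0_sqr.
Qed.

(** [tanh_] is a primitive of [phi0 ^ 2], and above [beta1] the integrand is 1/4. *)
Lemma area_phi_beta (beta : R) : 0 < beta ->
  L2_inner beta phi_beta phi_beta =
  PI * (2 * tanh_ (Rmin beta beta1) + (beta - Rmin beta beta1) / 2).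
Proof.
  intros Hb. pose proof beta1_pos as Hb1. pose proof cont2_phi_beta as Hpc.
  set (b := Rmin beta beta1).
  assert (Hb0 : 0 < b) by (apply Rmin_pos; auto).
  pose proof (Rmin_l beta beta1) as Hl. pose proof (Rmin_r beta beta1) as Hr.
  fold b in Hl, Hr.
  assert (Hc : forall y, continuous (fun y => phi_beta 0 y * phi_beta 0 y) y)
    by (intros; cont).
  assert (E : RInt (fun y => phi_beta 0 y * phi_beta 0 y) 0 beta = tanh_ b + (beta - b) / 4).
  { rewrite (RInt_split _ 0 b beta) by auto. f_equal.
    - rewrite (RInt_ext _ (fun y => phi0 y ^ 2)).
      + rewrite (RInt_antiderivative tanh_).
        * rewrite (tanh_sinh 0), sinh_0. unfold Rdiv. rewrite Rmult_0_l. apply Rminus_0_r.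
        * apply is_derive_tanh.
        * intros y. apply cont_pow, cont_phi0.
      + intros y Hy. rewrite Rmin_left, Rmax_right in Hy by lra.
        rewrite phi_beta_inner by lra. as_R. ring.
    - destruct (Rle_lt_dec beta beta1) as [H|H].
      + replace b with beta by (unfold b; rewrite Rmin_left; auto).
        rewrite RInt_point. change (@zero R_CompleteNormedModule) with 0. as_R. field.
      + assert (b = beta1) by (unfold b; apply Rmin_right; lra).
        rewrite (RInt_ext _ (fun y => 1 / 4)).
        * rewrite RInt_cst. as_R. field.
        * intros y Hy. rewrite Rmin_left, Rmax_right in Hy by lra.
          rewrite phi_beta_outer by lra. as_R. field. }
  unfold L2_inner.
  rewrite (RInt_ext _ (fun _ => 2 * tanh_ b + (beta - b) / 2)).
  - rewrite RInt_cst. as_R. ring.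
  - intros x _. rewrite (RInt_ext _ (fun y => phi_beta 0 y * phi_beta 0 y))
      by (intros; reflexivity).
    rewrite RInt_reflect by auto.
    rewrite (RInt_ext _ (fun y => 2 * (phi_beta 0 y * phi_beta 0 y))).
    + rewrite RInt_mulc by auto. rewrite E. as_R. field.
    + intros y _. rewrite (phi_beta_even 0 0 y). as_R. ring.
Qed.

Lemma tanh_pos (y : R) : 0 < y -> 0 < tanh_ y.
Proof.
  intros Hy. rewrite tanh_sinh. apply Rdiv_lt_0_compat; [|apply cosh_pos].
  rewrite <- sinh_0. now apply sinh_lt.
Qed.

(** The minimum of [f] over the compact fundamental domain bounds [f] on the whole strip by
    invariance, and a noncontractible curve has flat width at least PI. *)
Lemma sys_pos (beta : R) (f : R -> R -> R) : 0 < beta -> strip_metric f -> 0 < sys beta f.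
Proof.
  intros Hb (Hc & Hp & Hi). pose proof PI_RGT_0.
  destruct (continuous2_pos_min f 0 PI (- beta) beta Hc Hp) as (m & Hm & Hmin).
  apply Rlt_le_trans with (m * PI); [nra|].
  apply sys_ge; auto. intros gx gy k Hg.
  eapply Rle_trans; [|apply (curve_length_winding beta m f gx gy k Hc)]; auto; try lra.
  - assert (Hk : (1 <= Z.abs k)%Z) by (pose proof (proj1 Hg); lia).
    apply IZR_le in Hk. apply Rmult_le_compat_l; nra.
  - intros x y Hxy. destruct (fundamental_domain beta x y Hxy) as (x' & y' & Hx' & Hy' & E).
    rewrite (E f Hi). now apply Hmin.
Qed.

Section Stability.

Variables (beta : R) (f : R -> R -> R).
Hypotheses (Hbeta : 0 < beta) (Hf : strip_metric f).

Lemma projection_residual :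
  let d := fun x y => f x y - proj_phi_beta beta f x y in
  L2_inner beta d d = area beta f -
    L2_inner beta f phi_beta ^ 2 / L2_inner beta phi_beta phi_beta.
Proof.
  intros d. unfold d, proj_phi_beta, area.
  rewrite L2_inner_sub_scal; [|apply Hf|apply cont2_phi_beta].
  assert (L2_inner beta phi_beta phi_beta <> 0).
  { rewrite area_phi_beta by auto. pose proof PI_RGT_0.
    assert (0 < tanh_ (Rmin beta beta1)) by (apply tanh_pos, Rmin_pos; auto using beta1_pos).
    pose proof (Rmin_l beta beta1). nra. }
  field. auto.
Qed.

Lemma stability_inequality :
  let d := fun x y => f x y - proj_phi_beta beta f x y in
  L2_inner beta d d / sys beta f ^ 2 <=
  alpha_sys beta f - L2_inner beta phi_beta phi_beta / PI ^ 2.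
Proof.
  intros d. unfold d. rewrite projection_residual. unfold alpha_sys.
  pose proof (projection_inequality beta f Hbeta Hf) as HI.
  rewrite area_phi_beta by auto. pose proof PI_RGT_0.
  assert (Ht : 0 < tanh_ (Rmin beta beta1)) by (apply tanh_pos, Rmin_pos; auto using beta1_pos).
  pose proof (Rmin_l beta beta1) as Hl.
  pose proof (sys_pos beta f Hbeta Hf) as Hs.
  set (Q := 2 * tanh_ (Rmin beta beta1) + (beta - Rmin beta beta1) / 2) in *.
  assert (HQ : 0 < Q) by (unfold Q; lra).
  set (I := L2_inner beta f phi_beta) in *. set (s := sys beta f) in *.
  set (a := area beta f).
  replace ((a - I ^ 2 / (PI * Q)) / s ^ 2) with
    (a / s ^ 2 - I ^ 2 / (PI * Q * s ^ 2)) by (field; lra).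
  (* Over the common denominator the claim becomes (s Q)^2 <= I^2, the square of the projection
     inequality. *)
  replace (PI * Q / PI ^ 2) with ((s * Q) ^ 2 / (PI * Q * s ^ 2)) by (field; lra).
  apply Rplus_le_compat_l, Ropp_le_contravar.
  apply Rmult_le_compat_r.
  - apply Rlt_le, Rinv_0_lt_compat. apply Rmult_lt_0_compat; [nra|nra].
  - apply pow_incr. nra.
Qed.

End Stability.

Lemma alpha_sys_phi_beta (beta c : R) (f : R -> R -> R) : 0 < beta -> 0 < c ->
  continuous2 f -> (forall x y, in_strip beta x y -> f x y = c * phi_beta x y) ->
  alpha_sys beta f = L2_inner beta phi_beta phi_beta / PI ^ 2.
Proof.
  intros Hb Hc Hf H. unfold alpha_sys. rewrite (sys_scal_phi_beta beta c f) by auto.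
  assert (E : area beta f = c ^ 2 * L2_inner beta phi_beta phi_beta).
  { unfold area. rewrite (L2_inner_ext beta f f _ _ Hb H H).
    pose proof cont2_phi_beta as Hpc. unfold L2_inner.
    rewrite <- RInt_mulc.
    - apply RInt_ext. intros x _. rewrite <- RInt_mulc by (intros; cont).
      apply RInt_ext. intros y _. as_R. ring.
    - apply (continuous_RInt_param (fun x y => phi_beta x y * phi_beta x y)). intros x y; cont. }
  rewrite E. pose proof PI_RGT_0. field. lra.
Qed.

(** The extension is constant along vertical rays outside the strip. *)
Lemma conformal_factor_extension (beta : R) (phi : R -> R -> R) : 0 < beta ->
  conformal_factor beta phi ->
  exists f, strip_metric f /\ forall x y, in_strip beta x y -> f x y = phi x y.
Proof.
  intros Hb (Hpos & Hinv & eps & Heps & Hs).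
  (* Truncation of y to [- beta, beta], with the minimum written through [Rmax] so that [cont]
     applies. It is odd, which preserves invariance under A. *)
  set (clamp := fun y => Rmax (- beta) (- Rmax (- beta) (- y))).
  assert (Hcl : forall y, in_strip beta 0 (clamp y)).
  { intros y. unfold in_strip, clamp, Rmax. repeat destruct Rle_dec; lra. }
  assert (Hid : forall y, in_strip beta 0 y -> clamp y = y).
  { unfold in_strip. intros y Hy. unfold clamp, Rmax. repeat destruct Rle_dec; lra. }
  assert (Hodd : forall y, clamp (- y) = - clamp y).
  { intros y. unfold clamp, Rmax. repeat destruct Rle_dec; lra. }
  exists (fun x y => phi x (clamp y)). split; [split; [|split]|].
  - intros x y.
    apply (continuous_comp_2 (fun p : R * R => fst p) (fun p : R * R => clamp (snd p)) phi).
    + cont.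
    + unfold clamp. cont.
    + simpl. specialize (Hs O). simpl in Hs. apply Hs.
      destruct (Hcl y). lra.
  - intros x y. apply Hpos, Hcl.
  - intros x y. rewrite Hodd. apply Hinv, Hcl.
  - intros x y Hy. now rewrite Hid.
Qed.

(** * Smooth approximations of the extremal factor *)

Fixpoint Cn1 (n : nat) (h : R -> R) : Prop :=
  match n with
  | O => forall y, continuous h y
  | S m => (forall y, ex_derive h y) /\ Cn1 m (Derive h)
  end.

Lemma Cn1_derive (n : nat) (h dh : R -> R) :
  (forall y, is_derive h y (dh y)) -> Cn1 n dh -> Cn1 (S n) h.
Proof.
  intros H Hn. split; [intros y; eexists; apply H|].
  replace (Derive h) with dh; auto.
  extensionality y. symmetry. apply is_derive_unique, H.
Qed.

Lemma Cn1_cont (n : nat) (h : R -> R) : Cn1 n h -> forall y, continuous h y.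
Proof.
  destruct n; auto. intros [H _] y.
  apply (ex_derive_continuous (K := R_AbsRing) (V := R_NormedModule)), H.
Qed.

Lemma Cn1_pred (n : nat) (h : R -> R) : Cn1 (S n) h -> Cn1 n h.
Proof.
  revert h; induction n as [|n IH]; intros h H.
  - exact (Cn1_cont 1 h H).
  - destruct H as [H1 H2]. split; auto.
Qed.

Lemma Cn1_const (n : nat) (c : R) : Cn1 n (fun _ => c).
Proof.
  revert c; induction n as [|n IH]; intros c.
  - intros y. cont.
  - apply (Cn1_derive n _ (fun _ => 0)); auto. intros y. apply (is_derive_const c y).
Qed.

Lemma Cn1_plus (n : nat) (f g : R -> R) : Cn1 n f -> Cn1 n g -> Cn1 n (fun y => f y + g y).
Proof.
  revert f g; induction n as [|n IH]; intros f g Hf Hg.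
  - intros y. simpl in Hf, Hg. cont.
  - destruct Hf as [Hf1 Hf2], Hg as [Hg1 Hg2].
    apply (Cn1_derive n _ (fun y => Derive f y + Derive g y)).
    + intros y. apply (is_derive_plus f g); now apply Derive_correct.
    + now apply IH.
Qed.

Lemma Cn1_mult (n : nat) (f g : R -> R) : Cn1 n f -> Cn1 n g -> Cn1 n (fun y => f y * g y).
Proof.
  revert f g; induction n as [|n IH]; intros f g Hf Hg.
  - intros y. simpl in Hf, Hg. cont.
  - pose proof (Cn1_pred _ _ Hf). pose proof (Cn1_pred _ _ Hg).
    destruct Hf as [Hf1 Hf2], Hg as [Hg1 Hg2].
    apply (Cn1_derive n _ (fun y => Derive f y * g y + f y * Derive g y)).
    + intros y. auto_derive; auto.
      change (Derive (fun x => f x)) with (Derive f).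
      change (Derive (fun x => g x)) with (Derive g). ring.
    + apply Cn1_plus; apply IH; auto.
Qed.

(** The derivatives - phi0 tanh and phi0^2 are polynomials in the same two functions, hence the
    joint induction. *)
Lemma Cn1_phi0_tanh (n : nat) : Cn1 n phi0 /\ Cn1 n tanh_.
Proof.
  induction n as [|n [IH1 IH2]].
  - split; [exact cont_phi0|exact cont_tanh].
  - split.
    + apply (Cn1_derive n _ (fun y => (-1 * phi0 y) * tanh_ y)).
      * intros y. replace (-1 * phi0 y * tanh_ y) with (- phi0 y * tanh_ y) by ring.
        apply is_derive_phi0.
      * apply Cn1_mult; auto. apply Cn1_mult; auto. apply Cn1_const.
    + apply (Cn1_derive n _ (fun y => phi0 y * phi0 y)).
      * intros y. replace (phi0 y * phi0 y) with (phi0 y ^ 2) by ring. apply is_derive_tanh.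
      * now apply Cn1_mult.
Qed.

(** The derivatives of sqrt f and 1 / sqrt f are products of f' and powers of 1 / sqrt f, so
    regularity of the inverse root has to be carried along. *)
Lemma Cn1_sqrt (f : R -> R) : (forall y, 0 < f y) -> (forall n, Cn1 n f) ->
  forall n, Cn1 n (fun y => sqrt (f y)) /\ Cn1 n (fun y => / sqrt (f y)).
Proof.
  intros Hp Hf.
  assert (Hs : forall y, 0 < sqrt (f y)) by (intros; apply sqrt_lt_R0, Hp).
  assert (Hd : forall y, ex_derive f y) by (apply (Hf 1%nat)).
  induction n as [|n [IH1 IH2]].
  - pose proof (Cn1_cont 0 f (Hf O)) as Hc.
    split; intros y; cont. apply Rgt_not_eq, Hs.
  - assert (HDf : Cn1 n (Derive f)) by apply (Hf (S n)).
    split.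
    + apply (Cn1_derive n _ (fun y => / 2 * (Derive f y * / sqrt (f y)))).
      * intros y. specialize (Hs y). auto_derive; [split; auto|].
        change (Derive (fun x => f x)) with (Derive f). field. lra.
      * apply Cn1_mult; [apply Cn1_const|now apply Cn1_mult].
    + apply (Cn1_derive n _ (fun y =>
        - / 2 * (Derive f y * (/ sqrt (f y) * (/ sqrt (f y) * / sqrt (f y)))))).
      * intros y. specialize (Hs y). auto_derive; [repeat split; auto; lra|].
        change (Derive (fun x => f x)) with (Derive f). field. lra.
      * apply Cn1_mult; [apply Cn1_const|]. apply Cn1_mult; auto.
        apply Cn1_mult; auto. apply Cn1_mult; auto.
Qed.

Lemma Cn_of_Cn1 (n : nat) (U : R -> R -> Prop) (h : R -> R) :
  Cn1 n h -> Cn n U (fun _ y => h y).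
Proof.
  revert h; induction n as [|n IH]; intros h Hh.
  - intros x y _. simpl in Hh. cont.
  - pose proof (Cn1_cont _ _ Hh) as Hc. destruct Hh as [Hd Hh].
    split; [|split; [|split]].
    + intros x y _. cont.
    + intros x y _. split; [apply ex_derive_const|apply Hd].
    + replace (fun x y => Derive (fun _ : R => h y) x) with (fun _ _ : R => 0).
      * apply (IH (fun _ => 0)), Cn1_const.
      * extensionality x; extensionality y. symmetry. apply Derive_const.
    + apply (IH (Derive h)), Hh.
Qed.

(** The formula max (u, v) = (u + v + |u - v|) / 2 with |w| smoothed to sqrt (w^2 + del^2), here for
    u = [phi0 y] and v = 1/2. Differences and squares are spelled out to match [Cn1_plus] and
    [Cn1_mult]. *)
Definition smooth_max (del y : R) : R :=
  / 2 * ((phi0 y + 1 / 2) + sqrt ((phi0 y + - (1 / 2)) * (phi0 y + - (1 / 2)) + del * del)).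

Lemma smooth_max_bounds (del x y : R) : 0 < del ->
  phi_beta x y <= smooth_max del y <= phi_beta x y + del.
Proof.
  intros Hd. unfold smooth_max, phi_beta.
  set (u := phi0 y + - (1 / 2)).
  assert (H1 : Rabs u <= sqrt (u * u + del * del)).
  { replace (u * u + del * del) with (u ^ 2 + del ^ 2) by ring. apply abs_le_speed. }
  assert (H2 : sqrt (u * u + del * del) <= Rabs u + del).
  { pose proof (Rabs_pos u). rewrite <- (sqrt_pow2 (Rabs u + del)) by lra.
    apply sqrt_le_1_alt. pose proof (pow2_abs u). nra. }
  unfold u in *. unfold Rmax. destruct Rle_dec as [H|H].
  - rewrite Rabs_left1 in * by lra. lra.
  - rewrite Rabs_right in * by lra. lra.
Qed.

Lemma smooth_max_conformal (beta del : R) : 0 < del ->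
  conformal_factor beta (fun _ y => smooth_max del y).
Proof.
  intros Hd. split; [|split].
  - intros x y _. pose proof (smooth_max_bounds del x y Hd).
    pose proof (phi_beta_ge_half x y). lra.
  - intros x y _. unfold smooth_max. now rewrite phi0_even.
  - exists 1. split; [lra|]. intros n. apply Cn_of_Cn1.
    assert (Hu : forall n, Cn1 n (fun y => phi0 y + - (1 / 2)))
      by (intros m; apply Cn1_plus; [apply Cn1_phi0_tanh|apply Cn1_const]).
    unfold smooth_max. apply Cn1_mult; [apply Cn1_const|].
    apply Cn1_plus; [apply Cn1_plus; [apply Cn1_phi0_tanh|apply Cn1_const]|].
    apply (Cn1_sqrt (fun y => (phi0 y + - (1 / 2)) * (phi0 y + - (1 / 2)) + del * del)).
    + intros y. pose proof (Rle_0_sqr (phi0 y + - (1 / 2))) as H. unfold Rsqr in H. nra.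
    + intros m. apply Cn1_plus; [now apply Cn1_mult|apply Cn1_const].
Qed.

Lemma smooth_max_alpha (beta del : R) : 0 < beta -> 0 < del <= 1 ->
  alpha_sys beta (fun _ y => smooth_max del y) <=
  L2_inner beta phi_beta phi_beta / PI ^ 2 + 6 * beta / PI * del.
Proof.
  intros Hb Hd. pose proof PI_RGT_0 as Hpi.
  set (f := fun _ y : R => smooth_max del y).
  assert (Hc : forall y, continuous (smooth_max del) y).
  { intros y. unfold smooth_max. cont; try apply cont_phi0. }
  assert (Hf : continuous2 f) by (intros x y; unfold f; cont).
  pose proof cont2_phi_beta as Hpc.
  assert (Hs : PI <= sys beta f).
  { apply sys_ge; auto. intros gx gy k Hg. apply (length_ge_PI beta f gx gy k); auto.
    intros x y _. apply smooth_max_bounds. lra. }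
  (* With phi_beta <= 1 and del <= 1, (phi_beta + del)^2 exceeds phi_beta^2 by at most 3 del, over a
     domain of area 2 beta PI. *)
  assert (Ha : area beta f <= L2_inner beta phi_beta phi_beta + 6 * beta * PI * del).
  { unfold area, L2_inner.
    replace (6 * beta * PI * del) with (RInt (fun _ => RInt (fun _ => 3 * del) (- beta) beta) 0 PI).
    2:{ rewrite !RInt_cst. as_R. ring. }
    assert (Hi : forall u, continuous2 u -> forall x,
      continuous (fun x => RInt (fun y => u x y * u x y) (- beta) beta) x).
    { intros u Hu. apply (continuous_RInt_param (fun x y => u x y * u x y)). intros x y; cont. }
    rewrite <- RInt_add by (auto; intros; cont).
    apply RInt_mono; auto; try lra.
    - intros x. apply cont_plus; [now apply Hi|cont].
    - intros x _. rewrite <- RInt_add by (intros; cont).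
      apply RInt_mono; [intros; cont|intros; cont|lra|].
      intros y _. pose proof (smooth_max_bounds del x y (proj1 Hd)).
      pose proof (phi_beta_ge_half x y). pose proof (phi_beta_le_1 x y).
      unfold f. nra. }
  unfold alpha_sys.
  assert (Ha0 : 0 <= area beta f) by exact (L2_inner_self_nonneg beta f Hb Hf).
  apply Rle_trans with (area beta f / PI ^ 2).
  - apply Rmult_le_compat_l; auto. apply Rinv_le_contravar; [nra|]. apply pow_incr; lra.
  - replace (L2_inner beta phi_beta phi_beta / PI ^ 2 + 6 * beta / PI * del) with
      ((L2_inner beta phi_beta phi_beta + 6 * beta * PI * del) / PI ^ 2) by (field; lra).
    apply Rmult_le_compat_r; auto. apply Rlt_le, Rinv_0_lt_compat. nra.
Qed.

(** * The infimum over the conformal class and the equality case *)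

Lemma alpha_sys_ge (beta : R) (phi : R -> R -> R) : 0 < beta -> conformal_factor beta phi ->
  L2_inner beta phi_beta phi_beta / PI ^ 2 <= alpha_sys beta phi.
Proof.
  intros Hb Hphi. destruct (conformal_factor_extension beta phi Hb Hphi) as (f & Hf & E).
  rewrite <- (alpha_sys_ext beta f phi Hb E).
  pose proof (stability_inequality beta f Hb Hf) as H. simpl in H.
  pose proof (sys_pos beta f Hb Hf) as Hs.
  match type of H with ?u / ?v <= _ => assert (0 <= u / v) end.
  { apply Rdiv_le_0_compat; [|nra]. apply L2_inner_self_nonneg; auto.
    destruct Hf as [Hf _]. pose proof cont2_phi_beta.
    intros x y. unfold proj_phi_beta. cont. }
  simpl in *. lra.
Qed.

Lemma alpha_sys_conf_eq (beta : R) : 0 < beta ->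
  alpha_sys_conf beta = L2_inner beta phi_beta phi_beta / PI ^ 2.
Proof.
  intros Hb. pose proof PI_RGT_0 as Hpi. unfold alpha_sys_conf.
  set (a := L2_inner beta phi_beta phi_beta / PI ^ 2).
  set (E := fun a => exists phi, conformal_factor beta phi /\ a = alpha_sys beta phi).
  assert (HE : forall del, 0 < del -> E (alpha_sys beta (fun _ y => smooth_max del y))).
  { intros del Hd. exists (fun _ y => smooth_max del y).
    split; [exact (smooth_max_conformal beta del Hd)|reflexivity]. }
  assert (HEa : forall x, E x -> a <= x).
  { intros x (phi & Hphi & ->). now apply alpha_sys_ge. }
  destruct (real_Glb_Rbar E a _ HEa (HE 1 Rlt_0_1)) as [H1 H2].
  apply Rle_antisym; auto. apply le_epsilon. intros eps Heps.
  set (C := 6 * beta / PI). assert (HC : 0 < C) by (apply Rdiv_lt_0_compat; lra).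
  (* The error C del of [smooth_max_alpha] is then at most eps, and del <= 1 as that lemma
     requires. *)
  set (del := Rmin 1 (eps / C)).
  assert (Hd : 0 < del <= 1).
  { split; [apply Rmin_pos; [lra|apply Rdiv_lt_0_compat; lra]|apply Rmin_l]. }
  eapply Rle_trans; [apply H2, (HE del), Hd|].
  eapply Rle_trans; [apply smooth_max_alpha; auto|]. fold a C.
  apply Rplus_le_compat_l.
  replace eps with (C * (eps / C)) by (field; lra).
  apply Rmult_le_compat_l; [lra|apply Rmin_r].
Qed.

Theorem theorem1p3 (beta : R) (hbeta : 0 < beta) :
  (alpha_sys_conf beta = alpha_sys beta phi_beta /\
   alpha_sys beta phi_beta =
     (if Rle_dec beta beta1 then 2 / PI * tanh_ beta
      else sqrt 3 / PI + (beta - beta1) / (2 * PI))) /\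
  (forall phi : R -> R -> R, conformal_factor beta phi ->
     (let d := fun x y => phi x y - proj_phi_beta beta phi x y in
      L2_inner beta d d / (sys beta phi) ^ 2
        <= alpha_sys beta phi - alpha_sys_conf beta) /\
     (alpha_sys beta phi = alpha_sys_conf beta <->
      exists c, 0 < c /\
        forall x y, in_strip beta x y -> phi x y = c * phi_beta x y)).
Proof.
  pose proof PI_RGT_0 as Hpi.
  assert (Hself : alpha_sys beta phi_beta = L2_inner beta phi_beta phi_beta / PI ^ 2).
  { apply (alpha_sys_phi_beta beta 1); auto using cont2_phi_beta; [lra|intros; ring]. }
  split; [split|].
  - now rewrite alpha_sys_conf_eq, Hself.
  - rewrite Hself, area_phi_beta by auto. destruct Rle_dec as [H|H].
    + rewrite Rmin_left by auto. field. lra.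
    + rewrite Rmin_right by lra. rewrite (tanh_sinh beta1), sinh_beta1, cosh_beta1.
      field. lra.
  - intros phi Hphi. rewrite (alpha_sys_conf_eq beta hbeta).
    (* Every quantity in the claim depends only on values in the strip, so [phi] may be exchanged
       for its extension. *)
    destruct (conformal_factor_extension beta phi hbeta Hphi) as (f & Hf & E).
    pose proof (stability_inequality beta f hbeta Hf) as Hstab.
    rewrite <- (alpha_sys_ext beta f phi hbeta E), <- (sys_ext beta f phi E).
    pose proof (sys_pos beta f hbeta Hf) as Hs.
    assert (Ep : forall x y, proj_phi_beta beta f x y = proj_phi_beta beta phi x y).
    { intros x y. unfold proj_phi_beta.
      now rewrite (L2_inner_ext beta f phi_beta phi phi_beta hbeta E). }
    set (d := fun x y => f x y - proj_phi_beta beta f x y) in Hstab.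
    cbv zeta in Hstab.
    split.
    + intros d'.
      assert (Ed : forall x y, in_strip beta x y -> d' x y = d x y).
      { intros x y Hxy. unfold d, d'. now rewrite Ep, E. }
      rewrite (L2_inner_ext beta d' d' d d hbeta Ed Ed). exact Hstab.
    + split.
      * intros Heq. rewrite Heq, Rminus_diag in Hstab.
        set (c := L2_inner beta f phi_beta / L2_inner beta phi_beta phi_beta).
        (* Equality makes the right side of the stability inequality zero, so the residual has zero
           norm. *)
        assert (Hd0 : L2_inner beta d d <= 0).
        { apply Rnot_lt_le. intros Hlt.
          assert (0 < L2_inner beta d d / sys beta f ^ 2)
            by (apply Rdiv_lt_0_compat; [exact Hlt|nra]).
          lra. }
        destruct Hf as (Hfc & Hfp & Hfi). pose proof cont2_phi_beta as Hpc.
        assert (Hdc : continuous2 d) by (intros x y; unfold d, proj_phi_beta; cont).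
        assert (Hfd : forall x y, in_strip beta x y -> f x y = c * phi_beta x y).
        (* The vanishing of [d] is known for 0 <= x <= PI only; invariance of both factors carries
           it to the strip. *)
        { intros x y Hxy.
          destruct (fundamental_domain beta x y Hxy) as (x' & y' & Hx' & Hy' & Hg).
          rewrite (Hg f Hfi), (Hg phi_beta) by (intros; apply phi_beta_even).
          pose proof (L2_inner_self_eq0 beta d hbeta Hdc Hd0 x' y' Hx' Hy') as H0.
          unfold d, proj_phi_beta in H0. fold c in H0. lra. }
        exists c. split.
        (* The sign of c is read off at the origin, where both factors are positive. *)
        -- assert (H0 : in_strip beta 0 0) by (unfold in_strip; lra).
           specialize (Hfd 0 0 H0). specialize (Hfp 0 0).
           pose proof (phi_beta_ge_half 0 0). nra.
        -- intros x y Hxy. now rewrite <- E, Hfd.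
      * intros (c & Hc & Hphi'). apply (alpha_sys_phi_beta beta c f hbeta Hc (proj1 Hf)).
        intros x y Hxy. now rewrite E, Hphi'.
Qed.
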